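(* Let $n\ge 3$ and let $(W,S)$ be a Coxeter system with $S=\{s_1,\dots,s_n\}$ (distinct generators) such that $s_n$ commutes with $s_i$ for all $i\le n-2$, $s_{n-1}$ commutes with $s_i$ for all $i\le n-3$, $s_ns_{n-1}s_n=s_{n-1}s_ns_{n-1}$ and $s_{n-1}s_{n-2}s_{n-1}=s_{n-2}s_{n-1}s_{n-2}$. For $0\le i\le n$ let $W_i$ be the standard parabolic subgroup of $W$ generated by $\{s_1,\dots,s_i\}$ (so $W_n=W$ and $W_0=\{e\}$), and let $$f(W_i,l,a)=\left|\{w\in\mathcal{I}(W_i): w\text{ is Boolean},\ \ell(w)=l\text{ and }\ell'(w)=a\}\right|.$$ Then for $l\ge 3$ and $a\ge 1$, $$\begin{aligned} f(W_n,l,a)=\;& f(W_{n-1},l,a)+f(W_{n-1},l-2,a)\\ &+f(W_{n-2},l-1,a-1)-f(W_{n-2},l-2,a)\\ &+f(W_{n-2},l-3,a-1)-f(W_{n-3},l-3,a-1).\end{aligned}$$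
   Context: For a Coxeter system $(W,S)$: $\ell$ is the Coxeter length; the set of reflections is $T=\{wsw^{-1}:w\in W,s\in S\}$; the absolute length $\ell'(w)$ is the smallest $k$ such that $w$ is a product of $k$ reflections. $\mathcal{I}(W)$ is the set of involutions of $W$ (elements of order at most two, including $e$). For $w\in\mathcal{I}(W)$, let $B(w)=\{u\in\mathcal{I}(W):u\le w\}$, ordered by the restriction of the (strong) Bruhat order $\le$ on $W$; $w$ is Boolean if $B(w)$ is isomorphic to a Boolean lattice. Each $W_i$ is regarded as a Coxeter group with generators $\{s_1,\dots,s_i\}$. The relations among $s_1,\dots,s_{n-2}$ are otherwise arbitrary Coxeter relations. *)

(* Defs.v *)
From HB Require Import structures.
From mathcomp Require Import all_boot all_order ssralg ssrnum ssrint.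
From mathcomp Require Import finmap.
From mathcomp Require Import all_classical.
From Stdlib Require Import Relation_Operators.

Set Implicit Arguments.
Unset Strict Implicit.
Unset Printing Implicit Defensive.

Local Open Scope classical_set_scope.
Local Open Scope group_scope.

(* A matrix entry 0 stands for the label oo: the relation (s i * s j)^0 = 1 is
   then vacuous. *)
Definition coxeter_matrix (I : Type) (m : I -> I -> nat) : Prop :=
  [/\ forall i, m i i = 1%N,
      forall i j, m i j = m j i &
      forall i j, i <> j -> m i j <> 1%N].

Definition is_subgroup (W : groupType) (H : set W) : Prop :=
  H 1 /\ forall x y, H x -> H y -> H (x * y^-1).

Definition generated (W : groupType) (S : set W) : set W :=
  smallest (@is_subgroup W) S.

(* W = < s_i | (s_i s_j)^(m i j) = 1 >, the presentation being expressed by its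
   universal property (uniqueness of phi follows from generation). *)
Definition coxeter_presentation (I : Type) (W : groupType) (s : I -> W)
    (m : I -> I -> nat) : Prop :=
  [/\ generated (range s) = setT,
      forall i j, (s i * s j) ^+ m i j = 1 &
      forall (G : groupType) (f : I -> G),
        (forall i j, (f i * f j) ^+ m i j = 1) ->
        exists phi : {multiplicative W -> G}, forall i, phi (s i) = f i].

(* Injectivity means that the s_i are distinct generators. *)
Definition coxeter_system (I : Type) (W : groupType) (s : I -> W) : Prop :=
  injective s /\
  exists m : I -> I -> nat, coxeter_matrix m /\ coxeter_presentation s m.

(* The notions below are relative to a set S of generators and only concern
   the subgroup [generated S], so that a parabolic subgroup gets its own
   length, reflections and Bruhat order. *)

Definition product_of (W : groupType) (X : set W) (k : nat) (w : W) : Prop :=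
  exists ws : seq W,
    [/\ size ws = k, forall x, x \in ws -> X x & w = \prod_(x <- ws) x].

(* The value is 0 by convention when w is not a product of elements of X. *)
Definition word_length (W : groupType) (X : set W) (w : W) : nat :=
  xget 0%N [set k | product_of X k w /\
                    forall j, product_of X j w -> (k <= j)%N].

Definition reflections (W : groupType) (S : set W) : set W :=
  [set t | exists w s, [/\ generated S w, S s & t = w * s * w^-1]].

Definition coxeter_length (W : groupType) (S : set W) (w : W) : nat :=
  word_length S w.

Definition absolute_length (W : groupType) (S : set W) (w : W) : nat :=
  word_length (reflections S) w.

Definition bruhat_step (W : groupType) (S : set W) (u w : W) : Prop :=
  reflections S (u^-1 * w) /\ (coxeter_length S u < coxeter_length S w)%N.

Definition bruhat (W : groupType) (S : set W) : W -> W -> Prop :=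
  clos_refl_trans W (bruhat_step S).

Definition involutions (W : groupType) (S : set W) : set W :=
  [set w | generated S w /\ w * w = 1].

Definition involutions_below (W : groupType) (S : set W) (w : W) : set W :=
  [set u | involutions S u /\ bruhat S u w].

(* Boolean lattices are taken to be the lattices of subsets of a finite set:
   the posets involutions_below S w considered here are finite. *)
Definition boolean_involution (W : groupType) (S : set W) (w : W) : Prop :=
  involutions S w /\
  exists (k : nat) (phi : {set 'I_k} -> W),
    set_bij [set: {set 'I_k}] (involutions_below S w) phi /\
    forall A B : {set 'I_k}, A \subset B <-> bruhat S (phi A) (phi B).

(* 'I_n is 0-based: s_j is the value of s at the ordinal j - 1, so this is
   {s_1, ..., s_i}. *)
Definition first_gens (W : groupType) (n : nat) (s : 'I_n -> W) (i : nat) :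
    set W :=
  [set s j | j in [set j : 'I_n | (j.+1 <= i)%N]].

Definition boolean_involutions (W : groupType) (n : nat) (s : 'I_n -> W)
    (i l a : nat) : set W :=
  [set w | [/\ boolean_involution (first_gens s i) w,
               coxeter_length (first_gens s i) w = l &
               absolute_length (first_gens s i) w = a]].

(* fset_set is the empty set on infinite sets; boolean_involutions_finite
   shows that this case does not occur. *)
Definition num_boolean (W : groupType) (n : nat) (s : 'I_n -> W)
    (i l a : nat) : nat :=
  #|` fset_set (boolean_involutions s i l a)|.

Lemma generated_product_of (W : groupType) (S : set W) (w : W) :
  (forall x, S x -> x * x = 1) -> generated S w -> exists k, product_of S k w.
Proof.
move=> invS /(_ [set w | exists k, product_of S k w]); apply; split; last first.
  by move=> x Sx; exists 1%N, [:: x]; rewrite big_seq1; split=> // y;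
    rewrite inE => /eqP->.
split; first by exists 0%N, [::]; rewrite big_nil.
move=> x _ [k [xs [_ Sxs ->]]] [j [ys [_ Sys ->]]].
exists (size (xs ++ rev ys)), (xs ++ rev ys); split=> //.
  by move=> z; rewrite mem_cat mem_rev => /orP[/Sxs|/Sys].
rewrite big_cat /=; congr (_ * _).
elim: ys Sys => [|y ys IH] Sys; first by rewrite !big_nil invg1.
rewrite big_cons rev_cons -cats1 big_cat big_seq1 invgM IH; last first.
  by move=> z zys; apply: Sys; rewrite inE zys orbT.
congr (_ * _); apply: (mulgI y); rewrite mulgV invS //.
by apply: Sys; rewrite mem_head.
Qed.

Lemma coxeter_system_gen_invol (I : Type) (W : groupType) (s : I -> W) (i : I) :
  coxeter_system s -> s i * s i = 1.
Proof.
by case=> _ [m [[m1 _ _] [_ rel _]]]; have := rel i i; rewrite m1.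
Qed.

Lemma boolean_involutions_finite (W : groupType) (n : nat) (s : 'I_n -> W)
    (i l a : nat) :
  coxeter_system s -> finite_set (boolean_involutions s i l a).
Proof.
move=> cox; pose F (t : l.-tuple 'I_n) : W := \prod_(j <- t) s j.
apply: (@sub_finite_set _ _ (F @` setT)); last exact: finite_image.
move=> w [[[gw _] _] lw _].
have invS x : first_gens s i x -> x * x = 1.
  by case=> j _ <-; exact: coxeter_system_gen_invol.
have [k wk] := generated_product_of invS gw.
have : product_of (first_gens s i) l w.
  rewrite -lw /coxeter_length /word_length.
  have exk : exists k, `[< product_of (first_gens s i) k w >].
    by exists k; exact/asboolP.
  case: xgetP => [x _ [] //|none].
  case: (ex_minnP exk) => m /asboolP wm mmin.
  by case: (none m); split=> // j wj; apply: mmin; exact/asboolP.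
case=> ws [szws Sws ->].
have : exists js : seq 'I_n, ws = map s js.
  elim: ws Sws {szws} => [|x ws IH] Sws; first by exists [::].
  have [|js ->] := IH; first by move=> y yws; apply: Sws; rewrite inE yws orbT.
  have [j _ <-] := Sws x (mem_head _ _).
  by exists (j :: js).
case=> js ejs; have szjs : size js == l by rewrite -szws ejs size_map.
by exists (Tuple szjs) => //; rewrite /F ejs big_map.
Qed.

(* Main.v *)
(* Let a generator s act on an involution x by x |-> x s if s commutes with x, and
   by x |-> s x s otherwise. Every involution is reached from 1 by length-increasing
   actions; w is Boolean iff this is possible with pairwise distinct letters.
   Indeed the atoms of B(w) are the generators in the support of w, and an
   increasing expression is a chain in B(w), so for a Boolean w it has at most as
   many letters as there are atoms, all of which occur in it; conversely, for
   distinct letters, sending a set of letters to the corresponding subexpression is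
   an isomorphism onto B(w).
   For distinct letters s commutes with x iff it commutes with all the previous
   letters. Hence a commuting step adds 1 to both lengths, whereas a conjugating
   step adds 2 to the length and 0 to the absolute length: w is conjugate to a
   product of commuting simple reflections, whose number is the absolute length
   because it is the rank of w - 1 in the geometric representation.
   The recurrence sorts the Boolean w in W_n by the occurrences of p = s_n and
   q = s_(n-1): either p does not occur, or w = u p with q not occurring, or
   w = p v p with q occurring in v, or w = q u p q with u in W_(n-2) in which
   s_(n-2) occurs. *)

Require Import Defs.
From HB Require Import structures.
From mathcomp Require Import all_boot all_order all_algebra all_field.
From mathcomp Require Import finmap zify.
From mathcomp Require Import all_classical.
From Stdlib Require Import Relation_Operators.

Set Implicit Arguments.
Unset Strict Implicit.
Unset Printing Implicit Defensive.

Local Open Scope classical_set_scope.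
Local Open Scope group_scope.

(** * Word length, and the group that carries the inversion cocycle *)

Section WordLength.
Variables (W : groupType) (X : set W).

Lemma word_length_eq k w :
  product_of X k w -> (forall j, product_of X j w -> (k <= j)%N) ->
  word_length X w = k.
Proof.
move=> kw kmin; rewrite /word_length.
case: xgetP => [x _ [xw xmin]|/(_ k)[]]; last by split.
by apply/eqP; rewrite eqn_leq xmin // kmin.
Qed.

Lemma word_lengthP k w : product_of X k w -> product_of X (word_length X w) w.
Proof.
move=> kw; have exk : exists k, `[< product_of X k w >] by exists k; exact/asboolP.
case: (ex_minnP exk) => m /asboolP mw mmin.
by rewrite (word_length_eq mw) // => j jw; apply: mmin; exact/asboolP.
Qed.

Lemma word_length_le k w : product_of X k w -> (word_length X w <= k)%N.
Proof.
move=> kw; have exk : exists k, `[< product_of X k w >] by exists k; exact/asboolP.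
case: (ex_minnP exk) => m /asboolP mw mmin.
rewrite (word_length_eq mw) => [|j jw]; apply: mmin; exact/asboolP.
Qed.

Lemma product_ofM j k v w :
  product_of X j v -> product_of X k w -> product_of X (j + k) (v * w).
Proof.
case=> vs [<- Xvs ->] [ws [<- Xws ->]]; exists (vs ++ ws).
split; rewrite ?size_cat ?big_cat // => x.
by rewrite mem_cat => /orP[/Xvs|/Xws].
Qed.

Lemma product_of1 x : X x -> product_of X 1 x.
Proof.
move=> Xx; exists [:: x]; split=> //; last by rewrite big_seq1.
by move=> y; rewrite inE => /eqP->.
Qed.

End WordLength.

(* The semidirect product of the W-module of functions W -> Z/2 (W acting by
   conjugation on the argument) by W. *)
Definition twisted (W : groupType) : Type := (W * (W -> bool))%type.

HB.instance Definition _ (W : groupType) := gen_eqMixin (twisted W).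
HB.instance Definition _ (W : groupType) := gen_choiceMixin (twisted W).

Section Twisted.
Variable W : groupType.
Implicit Types f g : twisted W.

Definition twisted_one : twisted W := (1, fun _ => false).
Definition twisted_mul f g : twisted W :=
  (f.1 * g.1, fun x => f.2 x (+) g.2 (x ^ f.1)).
Definition twisted_inv f : twisted W := (f.1^-1, fun x => f.2 (x ^ f.1^-1)).

Lemma twisted_mulA : associative twisted_mul.
Proof.
move=> f g h; congr pair; first exact: mulgA.
by apply/funext => x /=; rewrite addbA conjgM.
Qed.

Lemma twisted_mul1 : left_id twisted_one twisted_mul.
Proof.
move=> [w f]; congr pair; first exact: mul1g.
by apply/funext => x /=; rewrite conjg1.
Qed.

Lemma twisted_mul1r : right_id twisted_one twisted_mul.
Proof.
move=> [w f]; congr pair; first exact: mulg1.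
by apply/funext => x /=; rewrite addbF.
Qed.

Lemma twisted_mulV : left_inverse twisted_one twisted_inv twisted_mul.
Proof.
move=> [w f]; congr pair; first exact: mulVg.
by apply/funext => x /=; rewrite addbb.
Qed.

Lemma twisted_mulVr : right_inverse twisted_one twisted_inv twisted_mul.
Proof.
move=> [w f]; congr pair; first exact: mulgV.
by apply/funext => x /=; rewrite conjgK addbb.
Qed.

End Twisted.

HB.instance Definition _ (W : groupType) := isGroup.Build (twisted W)
  (@twisted_mulA W) (@twisted_mul1 W) (@twisted_mul1r W)
  (@twisted_mulV W) (@twisted_mulVr W).

(** For checking the Coxeter relations in [twisted W]: the function part of a power is a parity
    taken along the conjugates of x by powers of [f.1]. *)
Lemma twisted_expg (W : groupType) (f : twisted W) (m : nat) :
  (f ^+ m).1 = f.1 ^+ m /\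
  forall x, (f ^+ m).2 x = \big[addb/false]_(k < m) f.2 (x ^ (f.1 ^+ k)).
Proof.
elim: m => [|m [IH1 IH2]]; first by split=> // x; rewrite big_ord0.
rewrite !expgSr; split=> [|x] /=; first by rewrite IH1.
by rewrite IH2 big_ord_recr /= IH1.
Qed.

Section Multiplicative.
Variables (G H : groupType) (f : {multiplicative G -> H}).

Lemma multiplicative1 : f 1 = 1.
Proof. by apply: (mulgI (f 1)); rewrite -gmulfM !mulg1. Qed.

Lemma multiplicativeV x : f x^-1 = (f x)^-1.
Proof. by apply: (mulgI (f x)); rewrite -gmulfM !mulgV multiplicative1. Qed.

End Multiplicative.

(** * The geometric representation of a dihedral group *)

Section InvertiblePairs.
Import GRing.Theory.
Local Open Scope ring_scope.
Variable R : pzRingType.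

Definition inverse_pair (p : R * R) := (p.1 * p.2 == 1) && (p.2 * p.1 == 1).

(** Units of R with their inverse carried as data. The universal property of a Coxeter presentation
    only maps into groups, so matrices enter through this type. *)
Record invertible := Invertible {
  invertible_val :> R * R;
  _ : inverse_pair invertible_val
}.

HB.instance Definition _ := [isSub for invertible_val].
HB.instance Definition _ := [Choice of invertible by <:].

Implicit Types x y z : invertible.

Lemma invertible_mulV x : x.1 * x.2 = 1.
Proof. by case: x => p /= /andP[/eqP]. Qed.

Lemma invertible_Vmul x : x.2 * x.1 = 1.
Proof. by case: x => p /= /andP[_ /eqP]. Qed.

Fact invertible_one_subproof : inverse_pair (1, 1).
Proof. by rewrite /inverse_pair mulr1 eqxx. Qed.

Fact invertible_mul_subproof x y : inverse_pair (x.1 * y.1, y.2 * x.2).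
Proof.
rewrite /inverse_pair /= -!mulrA (mulrA y.1) invertible_mulV mul1r.
by rewrite (mulrA x.2) invertible_Vmul mul1r invertible_mulV invertible_Vmul !eqxx.
Qed.

Fact invertible_inv_subproof x : inverse_pair (x.2, x.1).
Proof. by rewrite /inverse_pair /= invertible_mulV invertible_Vmul !eqxx. Qed.

Definition invertible_one := Invertible invertible_one_subproof.
Definition invertible_mul x y := Invertible (invertible_mul_subproof x y).
Definition invertible_inv x := Invertible (invertible_inv_subproof x).

Fact invertible_mulA : associative invertible_mul.
Proof. by move=> x y z; apply/val_inj; rewrite /= !mulrA. Qed.

Fact invertible_mul1 : left_id invertible_one invertible_mul.
Proof. by move=> x; apply/val_inj; case: x => [[a b] ab]; rewrite /= mul1r mulr1. Qed.

Fact invertible_mul1r : right_id invertible_one invertible_mul.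
Proof. by move=> x; apply/val_inj; case: x => [[a b] ab]; rewrite /= mul1r mulr1. Qed.

Fact invertible_mulVl : left_inverse invertible_one invertible_inv invertible_mul.
Proof. by move=> x; apply/val_inj; rewrite /= invertible_Vmul. Qed.

Fact invertible_mulVr : right_inverse invertible_one invertible_inv invertible_mul.
Proof. by move=> x; apply/val_inj; rewrite /= invertible_mulV. Qed.

HB.instance Definition _ := isGroup.Build invertible invertible_mulA
  invertible_mul1 invertible_mul1r invertible_mulVl invertible_mulVr.

Lemma invertible_val1 : (1%g : invertible).1 = 1. Proof. by []. Qed.

Lemma invertible_valM x y : (x * y)%g.1 = x.1 * y.1. Proof. by []. Qed.

Lemma invertible_valX x k : (x ^+ k)%g.1 = x.1 ^+ k.
Proof. by elim: k => // k IH; rewrite expgS exprS -IH. Qed.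

Lemma invertible_eq x y : x.1 = y.1 -> x = y.
Proof.
move=> e; apply/val_inj; rewrite [LHS]surjective_pairing [RHS]surjective_pairing.
congr pair => //=; rewrite -[x.2]mulr1 -(invertible_mulV y) -e mulrA.
by rewrite invertible_Vmul mul1r.
Qed.

End InvertiblePairs.

Section DihedralRelation.
Import GRing.Theory.
Local Open Scope ring_scope.
Variables (F : fieldType) (R : algType F) (X Y : R) (q : F) (m : nat).
Hypotheses (m_gt2 : (2 < m)%N) (prim_q : (m.*2).-primitive_root q).
Let c := q + q^-1.
Hypotheses (XX : X * X = - 2 *: X) (YY : Y * Y = - 2 *: Y).
Hypotheses (XYX : X * Y * X = c ^+ 2 *: X) (YXY : Y * X * Y = c ^+ 2 *: Y).

(* With P the product and z = q^2, (P - 1) (P - z) (P - z^-1) = 0, and 1, z, z^-1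
   are distinct m-th roots of unity. *)
Lemma dihedral_relation : ((1 + X) * (1 + Y)) ^+ m = 1.
Proof.
have q_neq0 : q != 0.
  apply/eqP => q0; have := prim_expr_order prim_q.
  by rewrite q0 expr0n; case: m m_gt2 => // k _ /eqP; rewrite eq_sym oner_eq0.
pose z := q ^+ 2; pose z' := q ^- 2.
have zz' : z * z' = 1 by rewrite divff // expf_neq0.
have c2 : c ^+ 2 = z + z' + 2.
  rewrite sqrrD divff // exprVn -/z -/z' -addrA [_ *+ 2 + _]addrC addrA.
  by rewrite -mulr_natl mulr1.
have zm : z ^+ m = 1 by rewrite -exprM mul2n (prim_expr_order prim_q).
have z'm : z' ^+ m = 1 by rewrite exprVn -exprM mul2n (prim_expr_order prim_q) invr1.
have m4 : (4 < m.*2)%N by rewrite (ltn_double 2).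
have z_neq1 : z != 1.
  by rewrite -(prim_order_dvd prim_q) gtnNdvd // (leq_trans _ m4).
have zNz' : z != z'.
  apply/eqP => e; have := zz'; rewrite -e /z -exprD => /eqP.
  by rewrite -(prim_order_dvd prim_q) gtnNdvd.
set P := (1 + X) * (1 + Y); pose P' := (1 + Y) * (1 + X); pose Z := P - 1.
have one_sub2 : 1 - 2 = -1 :> F by rewrite opprD addNKr.
have XX1 : X * (1 + X) = - X.
  by rewrite mulrDr mulr1 XX -{1}[X]scale1r -scalerDl one_sub2 scaleN1r.
have YY1 : Y * (1 + Y) = - Y.
  by rewrite mulrDr mulr1 YY -{1}[Y]scale1r -scalerDl one_sub2 scaleN1r.
have PP' : P' * P = 1.
  rewrite /P' /P mulrA -(mulrA (1 + Y) (1 + X) (1 + X)) [(1 + X) * (1 + X)]mulrDl.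
  by rewrite mul1r XX1 addrK mulr1 mulrDl mul1r YY1 addrK.
have cancel (U V T : R) : - (T + V) + (- T + (V + (U + (T + T)))) = U.
  by rewrite opprD addrACA addKr [U + _]addrC -opprD addKr.
have c2Z T : c ^+ 2 *: T = (z + z') *: T + (T + T).
  by rewrite c2 scalerDl scaler_nat mulr2n.
(* Right multiplication by [P + P'] is the scalar [z + z'] on X, and likewise on Y, hence on
   [Z = X + Y + X * Y]. *)
have XQ : X * (P + P') = (z + z') *: X.
  rewrite mulrDr /P /P' !mulrA XX1 mulNr [X * (1 + Y)]mulrDr mulr1.
  by rewrite [_ * (1 + X)]mulrDl XX1 [X * Y * _]mulrDr mulr1 XYX c2Z cancel.
have YQ : Y * (P + P') = (z + z') *: Y.
  rewrite addrC mulrDr /P /P' !mulrA YY1 mulNr [Y * (1 + X)]mulrDr mulr1.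
  by rewrite [_ * (1 + Y)]mulrDl YY1 [Y * X * _]mulrDr mulr1 YXY c2Z cancel.
have ZQ : Z * P + Z * P' = (z + z') *: Z.
  have -> : Z = X + Y + X * Y.
    rewrite /Z /P mulrDl mul1r mulrDr mulr1 addrAC [1 + Y]addrC addrK addrA.
    by rewrite [Y + X]addrC.
  by rewrite -mulrDr !mulrDl XQ YQ -mulrA YQ -scalerAr !scalerDr.
have eZ : Z = P - 1 by [].
clear XQ YQ; clearbody Z; clearbody P P'.
have ZP2 : Z * P * P = (z + z') *: (Z * P) - Z.
  by rewrite scalerAl -ZQ mulrDl -[Z * P' * P]mulrA PP' mulr1 addrK.
(* Eigenvectors of right multiplication by P for z and z'; their difference is [(z - z') *: Z], so
   it suffices that both kill the geometric sum in P. *)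
pose A := Z * P - z' *: Z; pose B := Z * P - z *: Z.
have stepA : A * P = z *: A.
  rewrite mulrBl ZP2 -scalerAl scalerBr scalerA zz' scale1r scalerDl.
  by rewrite addrAC addrK.
have stepB : B * P = z' *: B.
  rewrite mulrBl ZP2 -scalerAl scalerBr scalerA [z' * z]mulrC zz' scale1r scalerDl.
  by rewrite [z *: _ + _]addrC addrAC addrK.
have geom (T : R) x : T * P = x *: T -> x != 1 -> x ^+ m = 1 ->
    T * (\sum_(k < m) P ^+ k) = 0.
  move=> TP x1 xm; have TPk k : T * P ^+ k = x ^+ k *: T.
    elim: k => [|k IH]; first by rewrite mulr1 scale1r.
    by rewrite exprSr mulrA IH -scalerAl TP scalerA -exprSr.
  rewrite mulr_sumr; under eq_bigr do rewrite TPk.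
  rewrite -scaler_suml.
  have /eqP := subrX1 x m; rewrite xm subrr eq_sym mulf_eq0 subr_eq0 (negbTE x1) /=.
  by move=> /eqP->; rewrite scale0r.
have z'_neq1 : z' != 1.
  by apply: contra z_neq1 => /eqP e; rewrite -zz' e mulr1.
have AB : A - B = (z - z') *: Z.
  by rewrite /A /B opprB addrC addrA subrK scalerBl.
apply/eqP; rewrite -subr_eq0 subrX1 -eZ.
have: (z - z') *: (Z * \sum_(k < m) P ^+ k) == 0.
  by rewrite scalerAl -AB mulrBl (geom A z) // (geom B z') // subrr.
by rewrite scaler_eq0 subr_eq0 (negbTE zNz').
Qed.

End DihedralRelation.

(** * Exchange condition *)

Section Words.
Variables (I : eqType) (W : groupType) (s : I -> W).
Hypothesis cox : coxeter_system s.
Implicit Types (i j : I) (ws us : seq I) (x y w t : W) (J : pred I).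

Local Notation invol := (coxeter_system_gen_invol _ cox).

Lemma gen_inv i : (s i)^-1 = s i.
Proof. exact/mulg1_eq/invol. Qed.

Lemma gen_mulK i x : s i * (s i * x) = x.
Proof. by rewrite mulgA invol mul1g. Qed.

Lemma gen_mulKr i x : x * s i * s i = x.
Proof. by rewrite -mulgA invol mulg1. Qed.

Definition wprod ws : W := \prod_(j <- ws) s j.

Lemma wprod_nil : wprod [::] = 1. Proof. exact: big_nil. Qed.

Lemma wprod_cons j ws : wprod (j :: ws) = s j * wprod ws.
Proof. exact: big_cons. Qed.

Lemma wprod_cat ws us : wprod (ws ++ us) = wprod ws * wprod us.
Proof. exact: big_cat. Qed.

Lemma wprod_rcons ws j : wprod (rcons ws j) = wprod ws * s j.
Proof. by rewrite -cats1 wprod_cat wprod_cons wprod_nil mulg1. Qed.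

Lemma wprod_rev ws : wprod (rev ws) = (wprod ws)^-1.
Proof.
elim: ws => [|j ws IH]; first by rewrite wprod_nil invg1.
by rewrite rev_cons wprod_rcons wprod_cons invgM IH gen_inv.
Qed.

Definition gens J : set W := [set s j | j in [set j | J j]].

Definition in_parabolic J x := exists2 ws, all J ws & x = wprod ws.

Lemma parabolic_wprod J ws : all J ws -> in_parabolic J (wprod ws).
Proof. by exists ws. Qed.

Lemma parabolic1 J : in_parabolic J 1.
Proof. by exists [::]; rewrite ?wprod_nil. Qed.

Lemma parabolicM J x y :
  in_parabolic J x -> in_parabolic J y -> in_parabolic J (x * y).
Proof.
move=> [ws Jws ->] [us Jus ->].
by exists (ws ++ us); rewrite ?all_cat ?Jws ?wprod_cat.
Qed.

Lemma parabolicV J x : in_parabolic J x -> in_parabolic J x^-1.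
Proof. by move=> [ws Jws ->]; exists (rev ws); rewrite ?all_rev ?wprod_rev. Qed.

Lemma parabolic_gen J j : J j -> in_parabolic J (s j).
Proof. by move=> Jj; exists [:: j]; rewrite /= ?Jj ?wprod_cons ?wprod_nil ?mulg1. Qed.

Lemma parabolicS J J' x : subpred J J' -> in_parabolic J x -> in_parabolic J' x.
Proof. by move=> sJ [ws Jws ->]; exists ws => //; apply: sub_all Jws. Qed.

Lemma parabolicMr J x y :
  in_parabolic J x -> in_parabolic J (x * y) -> in_parabolic J y.
Proof.
by move=> Jx Jxy; rewrite -(mulKg x y); apply: parabolicM Jxy; exact: parabolicV.
Qed.

Lemma parabolicMl J x y :
  in_parabolic J y -> in_parabolic J (x * y) -> in_parabolic J x.
Proof.
by move=> Jx Jxy; rewrite -(mulgK y x); apply: parabolicM Jxy _; exact: parabolicV.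
Qed.

Lemma product_of_gens J k x :
  product_of (gens J) k x <-> exists ws, [/\ size ws = k, all J ws & x = wprod ws].
Proof.
split=> [[vs [<- Jvs ->]]|[ws [<- Jws ->]]].
  elim: vs Jvs => [|v vs IH] Jvs; first by exists [::]; rewrite big_nil wprod_nil.
  have [j Jj <-] := Jvs v (mem_head _ _).
  have [|ws [ews Jws e]] := IH.
    by move=> z zvs; apply: Jvs; rewrite inE zvs orbT.
  exists (j :: ws); split=> //=; [by rewrite ews|exact/andP|].
  by rewrite big_cons e wprod_cons.
exists (map s ws); rewrite size_map; split=> //; last by rewrite big_map.
by move=> v /mapP[j jws ->]; exists j => //; exact: (allP Jws).
Qed.

Lemma generated_gens J x : generated (gens J) x <-> in_parabolic J x.
Proof.
split=> [gx|[ws Jws ->] H [[H1 Hdiv] HJ]].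
  have [|k /product_of_gens[ws [_ Jws ->]]] := @generated_product_of _ (gens J) x _ gx.
    by move=> v [j _ <-]; exact: invol.
  by exists ws.
have HV y : H y -> H y^-1 by move=> Hy; rewrite -[y^-1]mul1g; exact: Hdiv.
elim: ws Jws => [|j ws IH]; first by rewrite wprod_nil.
case/andP=> Jj Jws; rewrite wprod_cons -[wprod ws]invgK; apply: Hdiv.
  by apply: HJ; exists j.
exact/HV/IH.
Qed.

Lemma range_gens : range s = gens xpredT.
Proof. by congr image; apply/seteqP; split. Qed.

Lemma in_full_parabolic x : in_parabolic xpredT x.
Proof.
apply/generated_gens; rewrite -range_gens.
by case: cox => _ [m [_ [-> _ _]]].
Qed.

(** The universal property lifts [s i] to the pair of [s i] and its indicator function in
    [twisted W]. The function part of this lift is N, and multiplicativity of the lift is the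
    cocycle identity. *)
Lemma inversion_cocycle_exists : exists N : W -> W -> bool,
  (forall i x, N (s i) x = (x == s i)) /\
  (forall v w x, N (v * w) x = N v x (+) N w (x ^ v)).
Proof.
have [_ [m [[mii mC _] [gens_s rel univ]]]] := cox.
pose f i : twisted W := (s i, fun x => x == s i).
have frel i j : (f i * f j) ^+ m i j = 1.
  have [e1 e2] := twisted_expg (f i * f j) (m i j).
  suff e3 : ((f i * f j) ^+ m i j).2 = fun=> false.
    by case: (_ ^+ _) e1 e3 => u v /= -> ->; rewrite rel.
  apply/funext => x; rewrite e2 /=; set p := s i * s j.
  (* The left inversions of the word (s_i s_j)^m are the p^r s_i for r < 2m,
     and p^m = 1 makes each of them occur twice. *)
  have ip k : s i * p ^- k = p ^+ k * s i.
    elim: k => [|k IH]; first by rewrite invg1 mulg1 mul1g.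
    have sp : s i * p^-1 = p * s i by rewrite /p invgM !gen_inv mulgA.
    by rewrite expgSr invgM mulgA sp -mulgA IH mulgA -expgS expgSr.
  have eX k : (x ^ (p ^+ k) == s i) = (x == p ^+ k.*2 * s i).
    rewrite -[LHS](inj_eq (@conjg_inj _ (p ^- k))) conjgK; congr (x == _).
    by rewrite conjgE invgK ip mulgA -expgnDr addnn.
  have eY k : ((x ^ p ^+ k) ^ s i == s j) = (x == p ^+ k.*2.+1 * s i).
    rewrite -conjgM -[LHS](inj_eq (@conjg_inj _ (p ^+ k * s i)^-1)) conjgK.
    congr (x == _); rewrite conjgE invgK invgM gen_inv ip.
    have -> : p ^+ k * s i * (s j * (p ^+ k * s i)) = p ^+ k * p * p ^+ k * s i.
      by rewrite !mulgA.
    by rewrite -expgSr -expgnDr addSn addnn.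
  under eq_bigr => k _ do rewrite eX eY.
  pose g r := x == p ^+ r * s i.
  have -> : \big[addb/false]_(k < m i j) (g k.*2 (+) g k.*2.+1)
      = \big[addb/false]_(r < m i j + m i j) g r.
    rewrite addnn; elim: (m i j) => [|k IH]; first by rewrite !big_ord0.
    by rewrite big_ord_recr IH doubleS !big_ord_recr /= addbA.
  rewrite big_split_ord /= -big_split big1 // => k _ /=.
  by rewrite /g expgnDr rel mul1g addbb.
have [phi phis] := univ _ f frel.
(* The lift is a section of the projection to W, since it is one on the generators. *)
have fst_phi x : (phi x).1 = x.
  have gx : generated (range s) x by rewrite gens_s.
  apply: (gx [set y | (phi y).1 = y]); split=> [|_ [i _ <-]]; last by rewrite /= phis.
  split=> [|y z /= ey ez]; first by rewrite /= multiplicative1.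
  by rewrite gmulfM multiplicativeV /= ey ez.
exists (fun w => (phi w).2); split=> [i x|v w x]; first by rewrite phis.
by rewrite gmulfM /= fst_phi.
Qed.

(* Meant for reflections x, for which inversion w x says that len (x * w) < len w
   (inversionE); being a cocycle, it can be defined before the length. *)
Definition inversion : W -> W -> bool := projT1 (cid inversion_cocycle_exists).

Lemma inversion_gen i x : inversion (s i) x = (x == s i).
Proof. by rewrite /inversion; case: cid => N [/= ? ?]. Qed.

Lemma inversionM v w x : inversion (v * w) x = inversion v x (+) inversion w (x ^ v).
Proof. by rewrite /inversion; case: cid => N [/= ? ?]. Qed.

Lemma inversion1 x : inversion 1 x = false.
Proof. by have := inversionM 1 1 x; rewrite mulg1 conjg1 addbb. Qed.

Lemma inversion_genM i w x :
  inversion (s i * w) x = (x == s i) (+) inversion w (x ^ s i).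
Proof. by rewrite inversionM inversion_gen. Qed.

Definition reflection t := exists i x, t = x * s i * x^-1.

Lemma reflection_gen i : reflection (s i).
Proof. by exists i, 1; rewrite invg1 mulg1 mul1g. Qed.

Lemma reflection_invol t : reflection t -> t * t = 1.
Proof. by move=> [i [x ->]]; rewrite -!mulgA mulKg gen_mulK mulgV. Qed.

(** Expand the cocycle along [t = x * s i * x^-1]: the contributions of x and of its inverse cancel,
    as [x * x^-1 = 1] shows, and only that of [s i] remains. *)
Lemma inversion_reflection t : reflection t -> inversion t t.
Proof.
move=> [i [x ->]]; set t' := (X in inversion _ X).
have tx : t' ^ x = s i by rewrite conjgE /t' -!mulgA mulVg mulg1 mulKg.
have := inversionM x x^-1 t'; rewrite mulgV inversion1 tx => /esym e.
rewrite -mulgA inversionM tx inversionM inversion_gen eqxx.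
rewrite conjgE mulKg.
by rewrite addbCA e.
Qed.

(** By the cocycle identity, t is either the first letter or conjugate by it to an inversion of the
    rest of the word; recursion finds the letter to delete. *)
Lemma strong_exchange ws t : inversion (wprod ws) t ->
  exists us j vs, [/\ ws = us ++ j :: vs, t = wprod us * s j * (wprod us)^-1
                    & t * wprod ws = wprod (us ++ vs)].
Proof.
elim: ws t => [|i ws IH] t; first by rewrite wprod_nil inversion1.
rewrite wprod_cons inversion_genM; case: eqVneq => [-> _|_ /= /IH].
  exists [::], i, ws; split=> //; last by rewrite gen_mulK.
  by rewrite wprod_nil invg1 mulg1 mul1g.
move=> [us [j [vs [-> et ew]]]]; exists (i :: us), j, vs; split=> //.
  rewrite wprod_cons invgM gen_inv.
  apply: (@conjg_inj _ (s i)); rewrite et conjgE gen_inv.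
  by rewrite -!mulgA gen_mulK invol mulg1.
rewrite wprod_cons -ew conjgE gen_inv -!mulgA gen_mulK.
by [].
Qed.

Lemma strong_exchange_parabolic J x t : in_parabolic J x -> inversion x t ->
  in_parabolic J t.
Proof.
move=> [ws Jws ->] /strong_exchange[us [j [vs [ews -> _]]]].
move: Jws; rewrite ews all_cat /= => /and3P[Jus Jj _].
apply: parabolicM; last exact/parabolicV/parabolic_wprod.
by apply: parabolicM; [exact: parabolic_wprod|exact: parabolic_gen].
Qed.

Definition len x := coxeter_length (range s) x.

Lemma len_word x : exists2 ws, x = wprod ws & size ws = len x.
Proof.
have [ws Tws ->] := in_full_parabolic x.
have : product_of (range s) (len (wprod ws)) (wprod ws).
  apply: word_lengthP; rewrite range_gens; apply/product_of_gens.
  by exists ws.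
by rewrite range_gens => /product_of_gens[us [eus _ e]]; exists us.
Qed.

Lemma len_le ws : (len (wprod ws) <= size ws)%N.
Proof.
apply: word_length_le; rewrite range_gens; apply/product_of_gens; exists ws.
by split=> //; apply/allP.
Qed.

Lemma len1 : len 1 = 0%N.
Proof. by apply/eqP; rewrite -leqn0 -wprod_nil len_le. Qed.

Lemma len_eq0 x : len x = 0%N -> x = 1.
Proof. by have [[|j ws] -> <-] := len_word x; rewrite ?wprod_nil. Qed.

Lemma lenV x : len x^-1 = len x.
Proof.
have le y : (len y^-1 <= len y)%N.
  by have [ws -> <-] := len_word y; rewrite -wprod_rev -(size_rev ws) len_le.
by apply/eqP; rewrite eqn_leq le -{1}[x]invgK le.
Qed.

Lemma inversion_lt x t : inversion x t -> (len (t * x) < len x)%N.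
Proof.
have [ws -> <-] := len_word x.
move=> /strong_exchange[us [j [vs [-> _ ->]]]].
by apply: leq_ltn_trans (len_le _) _; rewrite !size_cat /= addnS.
Qed.

(** If t is not an inversion of x, then it is one of [t * x]. *)
Lemma inversionN_lt x t : reflection t -> ~~ inversion x t -> (len x < len (t * x))%N.
Proof.
move=> rt Nt; rewrite -{1}[x]mul1g -(reflection_invol rt) -mulgA.
apply: inversion_lt; rewrite inversionM inversion_reflection //.
by rewrite conjgE mulKg (negbTE Nt).
Qed.

Lemma inversionE x t : reflection t -> inversion x t = (len (t * x) < len x)%N.
Proof.
move=> rt; case: (boolP (inversion x t)) => [/inversion_lt->//|/(inversionN_lt rt)].
by move/ltnW; rewrite leqNgt => /negbTE.
Qed.

Lemma len_genM_le i x : (len (s i * x) <= (len x).+1)%N.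
Proof. by have [ws -> <-] := len_word x; rewrite -wprod_cons; exact: len_le. Qed.

Lemma inversion_gen_len i x : inversion x (s i) -> len x = (len (s i * x)).+1.
Proof.
move/inversion_lt => lt; apply/eqP; rewrite eqn_leq lt andbT.
by rewrite -{1}[x](gen_mulK i) len_genM_le.
Qed.

Lemma inversionN_gen_len i x : ~~ inversion x (s i) -> len (s i * x) = (len x).+1.
Proof.
move/(inversionN_lt (reflection_gen i)) => lt.
by apply/eqP; rewrite eqn_leq len_genM_le lt.
Qed.

Lemma len_gen i : len (s i) = 1%N.
Proof.
rewrite -[s i]mulg1 inversionN_gen_len ?len1 //.
by rewrite inversion1.
Qed.

Definition reduced ws := size ws == len (wprod ws).

Lemma reduced_cons i ws : reduced (i :: ws) ->
  reduced ws /\ inversion (wprod (i :: ws)) (s i).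
Proof.
rewrite /reduced wprod_cons /= => /eqP e.
have e2 : len (wprod ws) = size ws.
  by apply/eqP; rewrite eqn_leq len_le -ltnS e len_genM_le.
rewrite e2 eqxx inversionE; last exact: reflection_gen.
by rewrite gen_mulK e2 -e.
Qed.

(** Deletion property: when a letter put before a reduced word does not lengthen it, strong exchange
    cancels that letter against another one. *)
Lemma reduced_subword ws : exists us,
  [/\ subseq us ws, reduced us & wprod us = wprod ws].
Proof.
have [k] := ubnP (size ws); elim: k ws => // k IH [|i ws] /= lk.
  by exists [::]; rewrite /reduced wprod_nil len1.
have [us [sus rus eus]] := IH ws lk.
case: (boolP (inversion (wprod us) (s i))) => [|Ni].
  move=> /strong_exchange[us1 [j [us2 [e _ ew]]]].
  have s12 : subseq (us1 ++ us2) ws.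
    apply: subseq_trans sus; rewrite e cat_subseq //; exact: subseq_cons.
  have [|vs [svs rvs evs]] := IH (us1 ++ us2).
    exact: leq_ltn_trans (size_subseq s12) lk.
  exists vs; split=> //; last by rewrite evs -ew wprod_cons -eus.
  exact: subseq_trans svs (subseq_trans s12 (subseq_cons _ _)).
exists (i :: us); split; first by rewrite /= eqxx.
  by rewrite /reduced wprod_cons inversionN_gen_len //= eqSS.
by rewrite !wprod_cons eus.
Qed.

Lemma parabolic_reduced J x : in_parabolic J x ->
  exists ws, [/\ all J ws, reduced ws & x = wprod ws].
Proof.
move=> [ws Jws ->]; have [us [sus rus <-]] := reduced_subword ws.
exists us; split=> //; apply/allP => j /(mem_subseq sus); exact: (allP Jws).
Qed.

Lemma parabolic_genP J i : in_parabolic J (s i) -> J i.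
Proof.
move=> /parabolic_reduced[ws [Jws]]; rewrite /reduced => + e.
rewrite -e len_gen; case: ws Jws e => [|j [|]] //=.
rewrite andbT wprod_cons wprod_nil mulg1 => Jj e _.
by case: cox => inj _; rewrite (inj _ _ e).
Qed.

(** The first letter of a reduced word is a left inversion of its product, so strong exchange puts
    it into the parabolic subgroup, and the rest follows by recursion. *)
Lemma reduced_parabolic J ws : reduced ws -> in_parabolic J (wprod ws) -> all J ws.
Proof.
elim: ws => //= i ws IH /reduced_cons[rws Ni] Jw.
have Ji := strong_exchange_parabolic Jw Ni.
rewrite (parabolic_genP Ji) IH //.
by rewrite -(gen_mulK i (wprod ws)) -wprod_cons; exact: parabolicM.
Qed.

Lemma inversion_parabolicN J i x : in_parabolic J x -> ~~ J i -> ~~ inversion x (s i).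
Proof.
by move=> Jx; apply: contra => /(strong_exchange_parabolic Jx)/parabolic_genP.
Qed.

Lemma len_genM_new J i x : in_parabolic J x -> ~~ J i -> len (s i * x) = (len x).+1.
Proof. by move=> Jx Ji; apply/inversionN_gen_len/(inversion_parabolicN Jx Ji). Qed.

Lemma len_Mgen_new J i x : in_parabolic J x -> ~~ J i -> len (x * s i) = (len x).+1.
Proof.
move=> /parabolicV Jx Ji; rewrite -lenV invgM gen_inv (len_genM_new Jx Ji).
by rewrite lenV.
Qed.

(** After [x * s i], one unit longer than x, left multiplication by [s i] could only shorten if
    [s i] were a left inversion of [x * s i]. As i is not in J, this would mean that x fixes [s i]
    under conjugation. *)
Lemma len_conj_new J i x : in_parabolic J x -> ~~ J i -> s i * x != x * s i ->
  len (s i * x * s i) = (len x).+2.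
Proof.
move=> Jx Ji ne; rewrite -mulgA inversionN_gen_len ?(len_Mgen_new Jx Ji) //.
rewrite inversionM (negbTE (inversion_parabolicN Jx Ji)) inversion_gen /=.
apply: contra ne => /eqP e; rewrite conjgC.
by rewrite e.
Qed.

(** Otherwise [s i * x * s i] has length [len x + 2]; lying in the parabolic subgroup it is
    lengthened by [s i], yet the result is [x * s i], of length [len x + 1]. *)
Lemma parabolic_conj_commute J i x : in_parabolic J x -> ~~ J i ->
  in_parabolic J (s i * x * s i) -> s i * x = x * s i.
Proof.
move=> Jx Ji Jy; apply/eqP/idPn => /(len_conj_new Jx Ji) e.
have := len_genM_new Jy Ji.
by rewrite e -mulgA gen_mulK (len_Mgen_new Jx Ji) => /eqP; rewrite eqSS ltn_eqF.
Qed.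

Lemma commute_wprod i ws : (forall j, j \in ws -> s i * s j = s j * s i) ->
  s i * wprod ws = wprod ws * s i.
Proof.
elim: ws => [|j ws IH] com; first by rewrite wprod_nil mulg1 mul1g.
rewrite wprod_cons mulgA com ?mem_head // -!mulgA IH // => k kws.
by apply: com; rewrite inE kws orbT.
Qed.

(* If s_i commutes with x then the set of left inversions of x is stable under
   conjugation by s_i; for the first letter j of ws this puts s_i s_j s_i in
   the parabolic subgroup generated by J. *)
Lemma commute_letters J i ws : all J ws -> reduced ws -> ~~ J i ->
  s i * wprod ws = wprod ws * s i -> forall j, j \in ws -> s i * s j = s j * s i.
Proof.
move=> + + Ji; elim: ws => //= j ws IH /andP[Jj Jws] /reduced_cons[rws Nj] com.
set x := wprod (j :: ws) in com Nj.
have Jx : in_parabolic J x by apply: parabolic_wprod; rewrite /= Jj.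
have Nji : inversion x (s j ^ s i).
  have := inversionM (s i) x (s j); rewrite com inversionM !inversion_gen Nj.
  have -> : (s j ^ x == s i) = (s j == s i).
    rewrite -[RHS](inj_eq (@conjg_inj _ x)); congr (_ == _).
    by rewrite conjgE com mulKg.
  by case: (s j == s i) => /=; case: (inversion x _).
have comj : s i * s j = s j * s i.
  apply: (@parabolic_conj_commute J) => //; first exact: parabolic_gen.
  have := strong_exchange_parabolic Jx Nji.
  by rewrite conjgE gen_inv mulgA.
move=> k; rewrite inE => /predU1P[->//|]; apply: IH => //.
apply: (mulgI (s j)); rewrite mulgA -comj -mulgA -wprod_cons com /x wprod_cons.
by rewrite mulgA.
Qed.

(** * Involution words *)

(* The paper's underlined expressions; the head of a list is the letter that acts
   last. *)
Definition star x i := if s i * x == x * s i then x * s i else s i * x * s i.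

Definition star_prod L := foldr (fun i x => star x i) 1 L.

(** The ordinary word underlying a list of actions; it is reduced when the letters are distinct. *)
Fixpoint star_expr L :=
  if L isn't i :: M then [::]
  else if s i * star_prod M == star_prod M * s i then i :: star_expr M
  else i :: rcons (star_expr M) i.

Fixpoint star_len L :=
  if L isn't i :: M then 0%N
  else if s i * star_prod M == star_prod M * s i then (star_len M).+1
  else (star_len M).+2.

Fixpoint star_abs L :=
  if L isn't i :: M then 0%N
  else if s i * star_prod M == star_prod M * s i then (star_abs M).+1
  else star_abs M.

Lemma star_prod_cons i L : star_prod (i :: L) = star (star_prod L) i.
Proof. by []. Qed.

Lemma wprod_star_expr L : wprod (star_expr L) = star_prod L.
Proof.
elim: L => [|i L IH]; first exact: wprod_nil.
rewrite star_prod_cons /star /=; case: eqP => [<-|_]; rewrite wprod_cons ?IH //.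
by rewrite wprod_rcons IH mulgA.
Qed.

Lemma mem_star_expr L : star_expr L =i L.
Proof.
elim: L => //= i L IH j; case: ifP => _; rewrite !inE ?IH //.
by rewrite mem_rcons inE IH orbA orbb.
Qed.

Lemma size_star_expr L : size (star_expr L) = star_len L.
Proof. by elim: L => //= i L IH; case: ifP => _ /=; rewrite ?size_rcons IH. Qed.

Lemma star_prod_parabolic J L : all J L -> in_parabolic J (star_prod L).
Proof.
move=> /allP JL; rewrite -wprod_star_expr; apply/parabolic_wprod/allP => j.
by rewrite mem_star_expr; exact: JL.
Qed.

Lemma star_invol x i : x * x = 1 -> star x i * star x i = 1.
Proof.
rewrite /star => xx; case: eqP => [e|_].
  by rewrite -{1}e -!mulgA (mulgA x x) xx mul1g invol.
by rewrite -!mulgA gen_mulK (mulgA x x) xx mul1g invol.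
Qed.

Lemma star_prod_invol L : star_prod L * star_prod L = 1.
Proof. by elim: L => [|i L IH]; [exact: mulg1|exact: star_invol]. Qed.

Lemma len_star_new J x i : in_parabolic J x -> ~~ J i ->
  len (star x i) = if s i * x == x * s i then (len x).+1 else (len x).+2.
Proof.
move=> Jx Ji; rewrite /star; case: ifPn => e; last exact: len_conj_new Jx Ji e.
exact: len_Mgen_new Jx Ji.
Qed.

Lemma mem_parabolic L : in_parabolic [in L] (star_prod L).
Proof. by apply: star_prod_parabolic; apply/allP. Qed.

Lemma len_star_prod L : uniq L -> len (star_prod L) = star_len L.
Proof.
elim: L => [|i L IH] /=; first by rewrite len1.
case/andP=> iL uL; rewrite (len_star_new (mem_parabolic L)) //.
by rewrite -/(star_prod L) IH.
Qed.

Lemma reduced_star_expr L : uniq L -> reduced (star_expr L).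
Proof.
by move=> uL; rewrite /reduced wprod_star_expr size_star_expr len_star_prod.
Qed.

(** This makes the type of each step depend on the letters alone. [star_expr L] is a reduced word
    with the letters of L, so [commute_letters] applies to it. *)
Lemma star_prod_commute L i : uniq (i :: L) ->
  (s i * star_prod L == star_prod L * s i) =
  all (fun j => s i * s j == s j * s i) L.
Proof.
move=> /= /andP[iL uL]; apply/eqP/allP => [com j jL|com]; last first.
  rewrite -wprod_star_expr; apply: commute_wprod => j.
  by rewrite mem_star_expr => /com/eqP.
apply/eqP; apply: (@commute_letters [in L] i (star_expr L)) => //.
- by apply/allP => k; rewrite mem_star_expr.
- exact: reduced_star_expr.
- by rewrite wprod_star_expr.
- by rewrite mem_star_expr.
Qed.

Lemma star_prod_support J L : uniq L -> in_parabolic J (star_prod L) -> all J L.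
Proof.
move=> uL; rewrite -wprod_star_expr => /(reduced_parabolic (reduced_star_expr uL)).
by move=> /allP Jw; apply/allP => j jL; apply: Jw; rewrite mem_star_expr.
Qed.

Lemma reflections_gens J t : reflections (gens J) t <->
  exists i x, [/\ J i, in_parabolic J x & t = x * s i * x^-1].
Proof.
split=> [[x [_ [/generated_gens Jx [i Ji <-] ->]]]|[i [x [Ji Jx ->]]]].
  by exists i, x.
by exists x, (s i); split=> //; [exact/generated_gens|exists i].
Qed.

Lemma reflectionsJ J t x : in_parabolic J x -> reflections (gens J) t ->
  reflections (gens J) (x * t * x^-1).
Proof.
move=> Jx /reflections_gens[i [y [Ji Jy ->]]]; apply/reflections_gens.
by exists i, (x * y); split; rewrite ?invgM ?mulgA //; exact: parabolicM.
Qed.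

Lemma reflections_parabolic J t : reflections (gens J) t -> in_parabolic J t.
Proof.
move=> /reflections_gens[i [x [Ji Jx ->]]]; apply: parabolicM (parabolicV Jx).
by apply: parabolicM => //; exact: parabolic_gen.
Qed.

Lemma reflections_reflection J t : reflections (gens J) t -> reflection t.
Proof. by move=> /reflections_gens[i [x [_ _ ->]]]; exists i, x. Qed.

Lemma product_of_reflectionsJ J k x w : in_parabolic J x ->
  product_of (reflections (gens J)) k w ->
  product_of (reflections (gens J)) k (x * w * x^-1).
Proof.
move=> Jx [ts [<- Jts ->]]; exists [seq x * t * x^-1 | t <- ts].
split; first by rewrite size_map.
  by move=> _ /mapP[t /Jts Jt ->]; exact: reflectionsJ.
elim: ts {Jts} => [|t ts IH]; first by rewrite !big_nil mulg1 mulgV.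
by rewrite /= !big_cons -IH !mulgA mulgVK.
Qed.

(** The upper bound for the absolute length: a commuting step appends one reflection, a conjugating
    step conjugates all the factors. *)
Lemma product_of_star_prod J L : all J L ->
  product_of (reflections (gens J)) (star_abs L) (star_prod L).
Proof.
elim: L => [|i L IH] /=; first by exists [::]; split=> //; rewrite big_nil.
case/andP=> Ji JL; rewrite /star -/(star_prod L); case: ifP => _; last first.
  rewrite -{2}(gen_inv i); apply: product_of_reflectionsJ (IH JL).
  exact: parabolic_gen.
rewrite -addn1; apply: product_ofM (IH JL) _; apply: product_of1.
apply/reflections_gens; exists i, 1; split=> //; first exact: parabolic1.
by rewrite invg1 mulg1 mul1g.
Qed.

(** Conjugating steps go into the conjugator x. The letter of a commuting step commutes with every
    letter of L, hence with x, and joins the core [ks]. *)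
Lemma star_prod_conj L : uniq L ->
  exists2 x, in_parabolic [in L] x & exists ks,
  [/\ uniq ks, {subset ks <= L}, size ks = star_abs L,
      {in ks &, forall i j, s i * s j = s j * s i}
    & star_prod L = x * wprod ks * x^-1].
Proof.
elim: L => [|i L IH] uiL.
  exists 1; first exact: parabolic1.
  by exists [::]; split=> //; rewrite wprod_nil !mul1g invg1.
have /= /andP[iL uL] := uiL.
have sub : {subset L <= i :: L} by move=> j; rewrite inE orbC => ->.
have [x Lx [ks [uks sks szks com ex]]] := IH uL.
rewrite /= /star star_prod_commute //; case: ifPn => [ci|nci]; last first.
  exists (s i * x).
    apply: parabolicM; last exact: parabolicS Lx.
    by apply: parabolic_gen; rewrite /= mem_head.
  exists ks; split=> //.
  - by move=> j /sks /sub.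
  - by rewrite -/(star_prod L) ex invgM gen_inv !mulgA.
exists x; first exact: parabolicS Lx.
exists (rcons ks i); split.
- by rewrite rcons_uniq uks andbT; apply: contra iL => /sks.
- by move=> j; rewrite mem_rcons !inE => /orP[->//|/sks->]; rewrite orbT.
- by rewrite size_rcons szks.
- move=> j k; rewrite !mem_rcons !inE => /predU1P[->|jks] /predU1P[->|kks] //.
  + by apply/eqP/(allP ci)/sks.
  + by apply/esym/eqP/(allP ci)/sks.
  + exact: com.
have [ws Lws ews] := parabolicV Lx.
rewrite -/(star_prod L) ex wprod_rcons -!mulgA; congr (_ * (_ * _)).
rewrite ews; apply/esym/commute_wprod => j /(allP Lws) jL.
exact/eqP/(allP ci).
Qed.

(** * Bruhat order below a distinct-letter expression *)

(** An element of a parabolic subgroup has a reduced word inside it, so its length there agrees with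
    its length in W. *)
Lemma coxeter_length_gens J x : in_parabolic J x -> coxeter_length (gens J) x = len x.
Proof.
move=> /parabolic_reduced[ws [Jws /eqP rws ->]]; apply: word_length_eq.
  by apply/product_of_gens; exists ws.
by move=> k /product_of_gens[us [<- _ ->]]; exact: len_le.
Qed.

(** Turns the right multiplication in [bruhat_step] into a left one, the side on which inversions
    and exchange are expressed. *)
Lemma bruhat_stepP J u w : in_parabolic J w -> bruhat_step (gens J) u w ->
  exists t, [/\ reflections (gens J) t, u = t * w, in_parabolic J u
              & (len u < len w)%N].
Proof.
move=> Jw [rt]; set t := u^-1 * w in rt; have Jt := reflections_parabolic rt.
have ew : w = u * t by rewrite mulVKg.
clearbody t.
have Ju : in_parabolic J u by apply: parabolicMl Jt _; rewrite -ew.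
rewrite !coxeter_length_gens // => lt; exists (u * t * u^-1); split=> //.
  exact: reflectionsJ.
rewrite ew mulgA mulgVK -mulgA (reflection_invol (reflections_reflection rt)).
by rewrite mulg1.
Qed.

Lemma bruhat_stepM J u t : in_parabolic J u -> reflections (gens J) t ->
  (len u < len (u * t))%N -> bruhat (gens J) u (u * t).
Proof.
move=> Ju rt lt; apply: rt_step; split; first by rewrite mulKg.
rewrite !coxeter_length_gens //; apply: parabolicM => //.
exact: reflections_parabolic.
Qed.

(** By strong exchange each step down deletes one letter. Arbitrary words are allowed because a
    deletion may leave a word that is not reduced. *)
Lemma bruhat_subword J u ws : all J ws -> bruhat (gens J) u (wprod ws) ->
  exists2 us, subseq us ws & u = wprod us.
Proof.
move=> Jws; move ew: (wprod ws) => w uw; elim: uw ws Jws ew => {u w}.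
- move=> u w st ws Jws ew; have Jw : in_parabolic J w by exists ws.
  have [t [rt eu _ lt]] := bruhat_stepP Jw st.
  have : inversion (wprod ws) t.
    by rewrite inversionE ?ew -?eu //; exact: reflections_reflection rt.
  move=> /strong_exchange[us [j [vs [ews _ e]]]]; exists (us ++ vs).
    by rewrite ews cat_subseq //; exact: subseq_cons.
  by rewrite eu -ew.
- by move=> u ws _ <-; exists ws.
move=> u v w _ IHuv _ IHvw ws Jws ew; have [vs svs ev] := IHvw ws Jws ew.
have [|us sus eu] := IHuv vs _ (esym ev); last first.
  by exists us => //; exact: subseq_trans svs.
by apply/allP => j /(mem_subseq svs); exact: (allP Jws).
Qed.

Lemma bruhat_parabolic J J' u w : subpred J J' -> in_parabolic J w ->
  bruhat (gens J') u w -> in_parabolic J u.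
Proof.
move=> sJ [ws Jws ->] /bruhat_subword[|us sus ->]; first exact: sub_all Jws.
by apply/parabolic_wprod/allP => j /(mem_subseq sus); exact: (allP Jws).
Qed.

Lemma bruhat_len J u w : in_parabolic J w -> bruhat (gens J) u w ->
  (len u <= len w)%N.
Proof.
move=> /parabolic_reduced[ws [Jws /eqP rws ->]] /(bruhat_subword Jws)[us sus ->].
by rewrite -rws; apply: leq_trans (len_le us) (size_subseq sus).
Qed.

(** All letters of a reduced word of v commute with [s i], and u is the product of some of them. *)
Lemma commute_below J u v i : in_parabolic J v -> ~~ J i -> bruhat (gens J) u v ->
  s i * v = v * s i -> s i * u = u * s i.
Proof.
move=> /parabolic_reduced[ws [Jws rws ->]] Ji /(bruhat_subword Jws)[us sus ->] com.
apply: commute_wprod => j /(mem_subseq sus); exact: (commute_letters Jws rws Ji com).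
Qed.

Lemma reflectionsS J K t : subpred K J ->
  reflections (gens K) t -> reflections (gens J) t.
Proof.
move=> sKJ /reflections_gens[j [x [Kj Kx ->]]]; apply/reflections_gens.
by exists j, x; split=> //; [exact: sKJ|exact: parabolicS Kx].
Qed.

(** A letter outside K adds 1 to every length in a chain from u to v, so each step remains a
    step. *)
Lemma bruhat_Mgen J K u v i : subpred K J -> in_parabolic K v -> ~~ K i -> J i ->
  bruhat (gens K) u v -> bruhat (gens J) (u * s i) (v * s i).
Proof.
move=> sKJ + Ki Ji uv; elim: uv => {u v} [u v st|u|u v w _ IHuv vw IHvw] Kv.
- have Ku := bruhat_parabolic (fun=> id) Kv (rt_step _ _ _ _ st).
  have [rt lt] := st.
  have -> : v * s i = u * s i * (s i * (u^-1 * v) * (s i)^-1).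
    by rewrite gen_inv !mulgA gen_mulKr mulgV mul1g.
  apply: bruhat_stepM.
  + by apply: parabolicM; [exact: parabolicS Ku|exact: parabolic_gen].
  + by apply: reflectionsJ (reflectionsS sKJ rt); exact: parabolic_gen.
  rewrite gen_inv !mulgA gen_mulKr mulgV mul1g.
  rewrite (len_Mgen_new Ku Ki) (len_Mgen_new Kv Ki).
  by move: lt; rewrite !coxeter_length_gens.
- exact: rt_refl.
exact: rt_trans (IHuv (bruhat_parabolic (fun=> id) Kv vw)) (IHvw Kv).
Qed.

(** Since u does not commute with [s i], nothing above it in the chain does, by [commute_below];
    conjugation therefore adds 2 to all the lengths. *)
Lemma bruhat_conj_gen J K u v i : subpred K J -> in_parabolic K v -> ~~ K i -> J i ->
  bruhat (gens K) u v -> s i * u != u * s i ->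
  bruhat (gens J) (s i * u * s i) (s i * v * s i).
Proof.
move=> sKJ + Ki Ji uv.
elim: uv => {u v} [u v st|u|u v w uv IHuv vw IHvw] Kv nu.
- have Ku := bruhat_parabolic (fun=> id) Kv (rt_step _ _ _ _ st).
  have nv : s i * v != v * s i.
    apply: contra nu => /eqP cv; apply/eqP; apply: commute_below Kv Ki _ cv.
    exact: rt_step.
  have [rt lt] := st.
  have e : s i * v * s i = s i * u * s i * (s i * (u^-1 * v) * (s i)^-1).
    by rewrite gen_inv !mulgA gen_mulKr -(mulgA (s i) u) mulgV mulg1.
  rewrite e; apply: bruhat_stepM.
  + apply: parabolicM (parabolic_gen Ji); apply: parabolicM (parabolic_gen Ji) _.
    exact: parabolicS Ku.
  + by apply: reflectionsJ (reflectionsS sKJ rt); exact: parabolic_gen.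
  rewrite -e (len_conj_new Ku) // (len_conj_new Kv) //.
  by move: lt; rewrite !coxeter_length_gens.
- exact: rt_refl.
have Kv' := bruhat_parabolic (fun=> id) Kv vw.
apply: rt_trans (IHuv Kv' nu) (IHvw Kv _).
apply: contra nu => /eqP cv; apply/eqP; exact: commute_below Kv' Ki uv cv.
Qed.

Lemma reflections_gen J i : J i -> reflections (gens J) (s i).
Proof.
move=> Ji; apply/reflections_gens; exists i, 1; split=> //; first exact: parabolic1.
by rewrite invg1 mulg1 mul1g.
Qed.

Lemma bruhat_star J K x i : subpred K J -> in_parabolic K x -> ~~ K i -> J i ->
  bruhat (gens J) (x * s i) (star x i).
Proof.
move=> sKJ Kx Ki Ji; rewrite /star; case: ifPn => nx; first exact: rt_refl.
have Jx : in_parabolic J x by exact: parabolicS Kx.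
have Jxi : in_parabolic J (x * s i) by apply: parabolicM Jx _; exact: parabolic_gen.
have e : s i * x * s i = x * s i * (s i ^ (x * s i)).
  by rewrite conjgE mulVKg mulgA.
rewrite e; apply: bruhat_stepM => //; last first.
  by rewrite -e (len_conj_new Kx) // (len_Mgen_new Kx).
rewrite conjgE -{2}[x * s i]invgK mulgA; apply: reflectionsJ.
  exact: parabolicV.
exact: reflections_gen.
Qed.

Lemma bruhat_star_prod J L' L : uniq L -> all J L -> subseq L' L ->
  bruhat (gens J) (star_prod L') (star_prod L).
Proof.
elim: L L' J => [|i L IH] L' J; first by move=> _ _ /eqP ->; exact: rt_refl.
move=> /= /andP[iL uL] /andP[Ji JL].
have sLJ : subpred [in L] J by move=> j; exact: (allP JL).
have KL := mem_parabolic L.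
have le_star : bruhat (gens J) (star_prod L * s i) (star (star_prod L) i).
  exact: bruhat_star KL iL Ji.
case: L' => [|j L'] /=.
  move=> _; apply: rt_trans (IH [::] J uL JL (sub0seq _)) _.
  apply: rt_trans le_star; apply: bruhat_stepM.
  - exact: parabolicS KL.
  - exact: reflections_gen.
  - by rewrite (len_Mgen_new KL).
case: eqVneq => [-> sL'|_ sL']; last first.
  apply: rt_trans (IH (j :: L') J uL JL sL') _.
  apply: rt_trans le_star; apply: bruhat_stepM.
  - exact: parabolicS KL.
  - exact: reflections_gen.
  - by rewrite (len_Mgen_new KL).
(* The induction hypothesis is used in the parabolic subgroup of L, where i is a new letter. If i
   commutes with the smaller product, [star_prod L * s i] serves as an intermediate element;
   otherwise both steps conjugate. *)
have le := IH L' [in L] uL (allss _) sL'.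
rewrite {1}/star; case: ifPn => [cL'|nL'].
  by apply: rt_trans le_star; exact: bruhat_Mgen le.
have nL : s i * star_prod L != star_prod L * s i.
  by apply: contra nL' => /eqP cL; apply/eqP; exact: commute_below KL iL le cL.
by rewrite /star (negbTE nL); exact: bruhat_conj_gen le nL'.
Qed.

Lemma conj_invol x i : x * x = 1 -> (s i * x * s i) * (s i * x * s i) = 1.
Proof. by move=> xx; rewrite -!mulgA gen_mulK (mulgA x x) xx mul1g invol. Qed.

(* For L = i :: M, the product of us is one of x, s_i x, x s_i, s_i x s_i where x is
   the product of a subword of star_expr M; if s_i x or x s_i is an involution then
   s_i x s_i = x^-1 lies in the parabolic subgroup of M, so s_i commutes with x. *)
Lemma subword_star_expr L us : uniq L -> subseq us (star_expr L) ->
  wprod us * wprod us = 1 ->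
  exists2 L', subseq L' L & wprod us = star_prod L'.
Proof.
elim: L us => [|i L IH] us.
  by move=> _ /eqP-> _; exists [::]; rewrite ?wprod_nil.
move=> uiL; have /= /andP[iL uL] := uiL.
have starE vs : subseq vs (star_expr L) -> wprod vs * wprod vs = 1 ->
    exists2 L', subseq L' (i :: L) & star (wprod vs) i = star_prod L'.
  move=> svs vs1; have [L' sL' ->] := IH vs uL svs vs1.
  by exists (i :: L'); rewrite //= eqxx.
have plainE vs : subseq vs (star_expr L) -> wprod vs * wprod vs = 1 ->
    exists2 L', subseq L' (i :: L) & wprod vs = star_prod L'.
  move=> svs vs1; have [L' sL' ->] := IH vs uL svs vs1.
  by exists L' => //; exact: subseq_trans sL' (subseq_cons _ _).
have parE vs : subseq vs (star_expr L) -> in_parabolic [in L] (wprod vs).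
  move=> svs; apply/parabolic_wprod/allP => j /(mem_subseq svs).
  by rewrite mem_star_expr.
have comE vs : subseq vs (star_expr L) -> s i * wprod vs = wprod vs * s i ->
    (s i * wprod vs) * (s i * wprod vs) = 1 ->
    exists2 L', subseq L' (i :: L) & s i * wprod vs = star_prod L'.
  move=> svs com e; have vs1 : wprod vs * wprod vs = 1.
    by rewrite -e {1}com -!mulgA gen_mulK.
  by have [L' sL' eL'] := starE vs svs vs1; exists L'; rewrite // -eL' /star com eqxx.
have invE vs : subseq vs (star_expr L) -> (s i * wprod vs) * (s i * wprod vs) = 1 ->
    s i * wprod vs = wprod vs * s i.
  move=> svs e; apply: (parabolic_conj_commute (parE vs svs) iL).
  have -> : s i * wprod vs * s i = (wprod vs)^-1.
    by apply: (mulIg (wprod vs)); rewrite mulVg -e !mulgA.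
  exact/parabolicV/parE.
case: ifPn => [com|ncom].
  case: us => [|j us] /=; first by move=> _; exact: plainE (sub0seq _).
  case: eqVneq => [->|_] sus; last exact: plainE.
  rewrite wprod_cons; apply: comE => //.
  apply: commute_wprod => k /(mem_subseq sus); rewrite mem_star_expr => kL.
  by apply/eqP; move: com; rewrite star_prod_commute // => /allP; apply.
have rcons_case vs : subseq vs (rcons (star_expr L) i) ->
    subseq vs (star_expr L) \/ exists2 ts, subseq ts (star_expr L) & vs = rcons ts i.
  case/lastP: vs => [|vs j]; first by left; exact: sub0seq.
  rewrite -subseq_rev !rev_rcons /=; case: eqVneq => [->|_].
    by rewrite subseq_rev => svs; right; exists vs.
  by rewrite -rev_rcons subseq_rev; left.
case: us => [|j us] /=; first by move=> _; exact: plainE (sub0seq _).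
(* Four cases, according to which of the two outer copies of i the subword keeps. *)
case: eqVneq => [->|_] /rcons_case[sus|[ts sts ets]] e.
- have com := invE _ sus; rewrite wprod_cons in e *; exact: comE (com e) e.
- rewrite ets wprod_cons wprod_rcons in e *.
  have ts1 : wprod ts * wprod ts = 1.
    by have := conj_invol i e; rewrite -!mulgA !gen_mulK invol mulg1.
  have [com|ncomt] := eqVneq (s i * wprod ts) (wprod ts * s i).
    by rewrite mulgA com gen_mulKr; exact: plainE.
  have [L' sL' eL'] := starE ts sts ts1; exists L' => //.
  by rewrite -eL' /star (negbTE ncomt) mulgA.
- exact: plainE.
rewrite ets wprod_rcons in e *.
have e' : s i * wprod ts * (s i * wprod ts) = 1.
  have := congr1 (fun x => x ^ s i) e.
  by rewrite conj1g conjgE gen_inv -!mulgA invol mulg1.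
by have com := invE _ sts e'; rewrite -com; exact: comE.
Qed.

Lemma involutions_star_prod J L : all J L -> involutions (gens J) (star_prod L).
Proof.
move=> JL; split; last exact: star_prod_invol.
exact/generated_gens/star_prod_parabolic.
Qed.

Lemma below_star_prod J L u : uniq L -> all J L ->
  involutions_below (gens J) (star_prod L) u <->
  exists2 L', subseq L' L & u = star_prod L'.
Proof.
move=> uL JL; split=> [[[_ u1]]|[L' sL' ->]]; last first.
  split; last exact: bruhat_star_prod.
  by apply/involutions_star_prod/allP => j /(mem_subseq sL'); exact: (allP JL).
rewrite -wprod_star_expr => /bruhat_subword[|us sus eu].
  by apply/allP => j; rewrite mem_star_expr; exact: (allP JL).
by have [|L' sL' e] := subword_star_expr uL sus; [rewrite -eu|exists L'; rewrite // eu].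
Qed.

Lemma boolean_star_prod J L : uniq L -> all J L ->
  boolean_involution (gens J) (star_prod L).
Proof.
move=> uL JL; split; first exact: involutions_star_prod.
pose sub (A : {set 'I_(size L)}) := [seq tnth (in_tuple L) k | k <- enum A].
have subP A k : (tnth (in_tuple L) k \in sub A) = (k \in A).
  by rewrite mem_map ?mem_enum //; exact/tuple_uniqP.
have sub_sub A : subseq (sub A) L.
  rewrite -[L in subseq _ L](map_tnth_enum (in_tuple L)).
  by apply: map_subseq; rewrite enumT; exact: filter_subseq.
have sub_mono (A B : {set 'I_(size L)}) : A \subset B -> subseq (sub A) (sub B).
  move=> sAB; apply: map_subseq.
  suff -> : enum A = [seq x <- enum B | x \in A] by exact: filter_subseq.
  rewrite -filter_predI; apply: eq_filter => k /=.
  by case: (boolP (k \in A)) => // /(fintype.subsetP sAB) ->.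
(* A distinct-letter product determines its letters; both injectivity and the reflection of the
   order come from this. *)
have parE A B : in_parabolic [in sub B] (star_prod (sub A)) -> A \subset B.
  move=> /(star_prod_support (subseq_uniq (sub_sub A) uL))/allP sAB.
  by apply/fintype.subsetP => k; rewrite -!subP => /sAB.
have allJ A : all J (sub A).
  by apply/allP => j /(mem_subseq (sub_sub A)); exact: (allP JL).
exists (size L), (fun A => star_prod (sub A)); split; last first.
  move=> A B; split=> [/sub_mono|le].
    by apply: bruhat_star_prod => //; exact: subseq_uniq (sub_sub B) uL.
  apply: parE; apply: bruhat_parabolic (mem_parabolic _) le.
  exact: (allP (allJ B)).
split.
- by move=> A _; apply/below_star_prod => //; exists (sub A).
- move=> A B _ _ e; apply/eqP; rewrite finset.eqEsubset !parE //.
    by rewrite -e; exact: mem_parabolic.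
  by rewrite e; exact: mem_parabolic.
move=> u /(below_star_prod _ uL JL)[L' sL' ->].
exists [set k | tnth (in_tuple L) k \in L']%SET => //; congr star_prod.
rewrite (subseq_uniqP uL (sub_sub _)) [RHS](subseq_uniqP uL sL').
apply: eq_in_filter => j /(tnthP (in_tuple L))[k ->].
by rewrite subP finset.inE.
Qed.

(** The suffixes of L give a chain in Bruhat order; the inequality of lengths makes it strict. *)
Fixpoint star_increasing J L : Prop :=
  if L isn't i :: M then True
  else [/\ star_increasing J M, (len (star_prod M) < len (star_prod L))%N
         & bruhat (gens J) (star_prod M) (star_prod L)].

Lemma involution_star_prod J w : in_parabolic J w -> w * w = 1 ->
  exists L, [/\ all J L, star_increasing J L & w = star_prod L].
Proof.
have [k] := ubnP (len w); elim: k w => // k IH w lk Jw w1.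
have [[|i ws] [Jws rws ew]] := parabolic_reduced Jw.
  by exists [::]; split=> //; rewrite ew wprod_nil.
have /andP[Ji _] : J i && all J ws by exact: Jws.
have [_] := reduced_cons rws; rewrite -ew => Ni.
have Jg := parabolic_gen Ji; have lw := inversion_gen_len Ni.
(* The witness is [star w i]: acting twice by the same letter gives back w, and i is a left descent
   of w. *)
suff [u [Ju u1 lu uw ew']] : exists u, [/\ in_parabolic J u, u * u = 1,
    (len u < len w)%N, bruhat (gens J) u w & w = star u i].
  have [|L [JL iL eL]] := IH u _ Ju u1; first exact: leq_trans lu _.
  have e : star_prod (i :: L) = w by rewrite star_prod_cons -eL ew'.
  exists (i :: L); split; rewrite ?e //=; first by rewrite Ji.
  by rewrite -[star _ i]/(star_prod (i :: L)) e -eL.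
have wV : w^-1 = w by apply: mulg1_eq.
have [com|ncom] := eqVneq (s i * w) (w * s i).
  have Jwi := parabolicM Jw Jg.
  have lt : (len (w * s i) < len w)%N by rewrite -com lw.
  exists (w * s i); split=> //.
  - by rewrite -{1}com -!mulgA (mulgA w w) w1 mul1g invol.
  - rewrite -{2}[w](gen_mulKr i); apply: bruhat_stepM => //.
      exact: reflections_gen.
    by rewrite gen_mulKr.
  - by rewrite /star mulgA com eqxx gen_mulKr.
have Jsws : in_parabolic J (s i * w * s i) by do 2 apply: parabolicM => //.
have lws : len (w * s i) = len (s i * w) by rewrite -lenV invgM wV gen_inv.
have l2 : (len (s i * w * s i) < len (w * s i))%N.
  (* [s i] is still a left inversion of [w * s i], for otherwise conjugation by w would fix it. *)
  rewrite -mulgA; apply: inversion_lt; rewrite inversionM Ni inversion_gen.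
  rewrite conjgE wV; apply/negP => /eqP e; case/negP: ncom.
  by rewrite -{2}e mulgA w1 mul1g.
exists (s i * w * s i); split=> //.
- exact: conj_invol.
- by rewrite lw; apply: leq_trans l2 _; rewrite lws.
(* Two Bruhat steps lead up: from [s i * w * s i] to [s i * w], then to w. *)
- apply: (@rt_trans _ _ _ (s i * w)).
    rewrite -{2}[s i * w](gen_mulKr i); apply: bruhat_stepM => //.
      exact: reflections_gen.
    by rewrite gen_mulKr -lws.
  have e : w = s i * w * (s i ^ w) by rewrite conjgE mulgA mulgK gen_mulK.
  rewrite {2}e; apply: bruhat_stepM; first exact: parabolicM.
    rewrite conjgE -{2}[w]invgK mulgA; apply: reflectionsJ.
      exact: parabolicV.
    exact: reflections_gen.
  by rewrite -e lw.
rewrite /star !mulgA invol mul1g.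
case: ifPn => [/eqP e|_]; last by rewrite gen_mulKr.
by case/eqP: ncom; rewrite e gen_mulKr.
Qed.

Lemma bruhat_anti1 J x : bruhat (gens J) x 1 -> x = 1.
Proof. by move=> /(bruhat_len (parabolic1 J)); rewrite len1 leqn0 => /eqP/len_eq0. Qed.

(** Removing the first letter of a reduced word goes down in Bruhat order, so the last letter lies
    below x. *)
Lemma parabolic_atom J x : in_parabolic J x -> x <> 1 ->
  exists2 i, J i & bruhat (gens J) (s i) x.
Proof.
move=> /parabolic_reduced[ws [Jws rws ->]] {x}.
elim: ws Jws rws => [|i ws IH]; first by rewrite wprod_nil.
move=> /= /andP[Ji Jws] riws _; have [rws Ni] := reduced_cons riws.
case: ws => [|j ws] in IH Jws riws rws Ni *.
  by exists i => //; rewrite wprod_cons wprod_nil mulg1; exact: rt_refl.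
have [|j' Jj' le] := IH Jws rws.
  by move=> e; move: rws; rewrite /reduced e len1.
exists j' => //; apply: rt_trans le _.
set x := wprod (j :: ws); have Jx : in_parabolic J x by exists (j :: ws).
have e : s i * x = x * (s i ^ x) by rewrite conjgE mulVKg.
rewrite wprod_cons -/x e; apply: bruhat_stepM => //.
  rewrite conjgE -{2}[x]invgK mulgA; apply: reflectionsJ.
    exact: parabolicV.
  exact: reflections_gen.
rewrite -e -wprod_cons (inversion_gen_len Ni) wprod_cons gen_mulK.
by [].
Qed.

Lemma one_below J x : in_parabolic J x -> bruhat (gens J) 1 x.
Proof.
move=> Jx; case: (eqVneq x 1) => [->|/eqP x1]; first exact: rt_refl.
have [i Ji le] := parabolic_atom Jx x1; apply: rt_trans le.
rewrite -[s i]mul1g; apply: bruhat_stepM; first exact: parabolic1.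
  exact: reflections_gen.
by rewrite mul1g len1 len_gen.
Qed.

Lemma boolean_involution_star J w : boolean_involution (gens J) w <->
  exists L, [/\ uniq L, all J L & w = star_prod L].
Proof.
split=> [[[/generated_gens Jw w1]]|[L [uL JL ->]]]; last exact: boolean_star_prod.
move=> [k [phi [[phiB phi_inj phi_surj] phi_mono]]].
have [L [JL incL ew]] := involution_star_prod Jw w1.
exists L; split=> //.
(* The chain of suffixes of M pulls back under [phi] to a strictly increasing chain of subsets of
   A. *)
have size_le M A : star_increasing J M -> bruhat (gens J) (star_prod M) w ->
    all J M -> phi A = star_prod M -> (size M <= #|A|)%N.
  elim: M A => // i M IH A [incM ltM leM] le /andP[Ji JM] eA.
  have leMw := rt_trans _ _ _ _ _ leM le.
  have [A' _ eA'] : [set phi x | x in setT] (star_prod M).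
    by apply: phi_surj; split=> //; exact: involutions_star_prod.
  have sA : A' \proper A.
    rewrite finset.properEneq; apply/andP; split; last first.
      by apply/phi_mono; rewrite eA' eA.
    by apply: contraTneq ltM => e; rewrite -eA -eA' e ltnn.
  by apply: leq_ltn_trans (IH A' incM leMw JM eA') (proper_card sA).
have sL : (size L <= k)%N.
  have [A _ eA] : [set phi x | x in setT] w.
    by apply: phi_surj; split; [split=> //; exact/generated_gens|exact: rt_refl].
  rewrite -[k]card_ord; apply: leq_trans (max_card (mem A)).
  by apply: size_le => //; rewrite -ew //; exact: rt_refl.
have below_gen i : J i -> bruhat (gens J) (s i) w -> i \in L.
  move=> Ji le; have : in_parabolic [in L] (s i); last exact: parabolic_genP.
  apply: bruhat_parabolic le; last by rewrite ew; exact: mem_parabolic.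
  exact: (allP JL).
have invol_gen i : J i -> involutions (gens J) (s i).
  by move=> Ji; split; [exact/generated_gens/parabolic_gen|exact: invol].
have phi0 : phi finset.set0 = 1.
  have [A _ eA] : [set phi x | x in setT] 1.
    apply: phi_surj; split; last exact: one_below.
    by split; [exact/generated_gens/parabolic1|exact: mulg1].
  apply: (@bruhat_anti1 J); rewrite -eA; apply/phi_mono; exact: finset.sub0set.
(* The image of a singleton is not 1, so it lies above some [s i]; the preimage of that generator is
   a nonempty part of the singleton. *)
have atom (j : 'I_k) : exists i, i \in L /\ phi [set j]%SET = s i.
  have [[/generated_gens Jx _] xw] := phiB [set j]%SET Logic.I.
  have x1 : phi [set j]%SET <> 1.
    move=> e; have : [set j]%SET = finset.set0.
      by apply: phi_inj; rewrite ?inE // e phi0.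
    by move/finset.setP/(_ j); rewrite !finset.inE eqxx.
  have [i Ji le] := parabolic_atom Jx x1.
  have lew := rt_trans _ _ _ _ _ le xw.
  exists i; split; first exact: below_gen.
  have [A _ eA] : [set phi x | x in setT] (s i).
    by apply: phi_surj; split=> //; exact: invol_gen.
  have : A \subset [set j]%SET by apply/phi_mono; rewrite eA.
  rewrite finset.subset1 => /orP[/eqP <- //|/eqP A0].
  by have := len_gen i; rewrite -eA A0 phi0 len1.
have {atom}[g gP] := choice atom.
have ug : uniq ([seq g r | r <- enum 'I_k] : seq I).
  rewrite map_inj_uniq ?enum_uniq // => r r' e; apply/finset.set1_inj/phi_inj.
  - exact: mem_set.
  - exact: mem_set.
  - by rewrite (gP r).2 (gP r').2 e.
(* L has at most k letters and contains these k distinct ones, so it has no repetition. *)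
apply: leq_size_uniq ug _ _; last by rewrite size_map size_enum_ord.
by move=> _ /mapP[r _ ->]; exact: (gP r).1.
Qed.

End Words.

(** * Lower bound for the absolute length *)

Section GeometricRepresentation.
Import GRing.Theory Num.Theory.
Local Open Scope ring_scope.
Variables (n : nat) (c : 'I_n.+1 -> 'I_n.+1 -> algC).
Implicit Types i j k : 'I_n.+1.

(** A rank-one matrix: on row vectors, [1 + root_part i] sends the basis vector [e_k] to
    [e_k + c k i *: e_i]. *)
Definition root_part i : 'M[algC]_n.+1 := (\col_k c k i) *m delta_mx 0 i.

Lemma root_partM i j :
  root_part i * root_part j = c i j *: ((\col_k c k i) *m delta_mx 0 j).
Proof.
rewrite -mulmxE /root_part mulmxA -(mulmxA _ (delta_mx 0 i)) -rowE.
have -> : row i (\col_k c k j) = (c i j)%:M.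
  by apply/matrixP => a b; rewrite !mxE !ord1 eqxx.
by rewrite mul_mx_scalar -scalemxAl.
Qed.

Lemma root_partMM i j :
  root_part i * root_part j * root_part i = (c i j * c j i) *: root_part i.
Proof.
rewrite {1}root_partM -scalerAl -scalerA; congr (_ *: _).
rewrite -mulmxE /root_part mulmxA -(mulmxA _ (delta_mx 0 j)) -rowE.
have -> : row j (\col_k c k i) = (c j i)%:M.
  by apply/matrixP => a b; rewrite !mxE !ord1 eqxx.
by rewrite mul_mx_scalar -scalemxAl.
Qed.

Lemma root_part_row i k : row k (root_part i) = c k i *: delta_mx 0 i.
Proof.
by apply/rowP => j; rewrite !mxE big_ord1 !mxE !eqxx.
Qed.

Hypothesis c_diag : forall i, c i i = - 2.

Lemma root_part_sqr i : root_part i * root_part i = - 2 *: root_part i.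
Proof. by rewrite root_partM c_diag. Qed.

Lemma simple_invol i : (1 + root_part i) * (1 + root_part i) = 1.
Proof.
rewrite mulrDl mul1r mulrDr mulr1 root_part_sqr -{2}[root_part i]scale1r -scalerDl.
by rewrite opprD addNKr scaleN1r addrK.
Qed.

Fact simple_inverse_pair i : inverse_pair (1 + root_part i, 1 + root_part i).
Proof. by rewrite /inverse_pair /= simple_invol eqxx. Qed.

Definition simple_matrix i : invertible 'M[algC]_n.+1 :=
  Invertible (simple_inverse_pair i).

Lemma mxrank_root_part i : (\rank (root_part i) <= 1)%N.
Proof. exact: leq_trans (mxrankM_maxr _ _) (rank_leq_row _). Qed.

End GeometricRepresentation.

Section AbsoluteLowerBound.
Import GRing.Theory Num.Theory.
Local Open Scope ring_scope.
Variables (n : nat) (W : groupType) (s : 'I_n.+1 -> W).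
Hypothesis cox : coxeter_system s.

Lemma geometric_representation : exists (c : 'I_n.+1 -> 'I_n.+1 -> algC)
    (rho : {multiplicative W -> invertible 'M[algC]_n.+1}),
  (forall i, c i i = - 2) /\ forall i, (rho (s i)).1 = 1 + root_part c i.
Proof.
have [_ [m [[mii mC m_neq1] [_ _ univ]]]] := cox.
have /choice[q qP] : forall k, exists q : algC, (0 < k)%N -> (k.*2).-primitive_root q.
  case=> [|k]; first by exists 0.
  by have [//|q qP] := @C_prim_root_exists (k.+1).*2; exists q.
(* q k + (q k)^-1 is a Galois conjugate of 2 cos (pi / k): positivity of the
   bilinear form plays no role here. *)
pose cm k := if k is 0 then 0 else q k + (q k)^-1.
pose c i j := cm (m i j).
have c_diag i : c i i = - 2.
  have p1 := qP 1%N isT; rewrite /c mii /cm.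
  have q1 : q 1%N = -1.
    have /eqP := prim_expr_order p1; rewrite sqrf_eq1 => /orP[/eqP q1|/eqP//].
    by have := prim_order_dvd p1 1; rewrite q1 expr1n eqxx.
  by rewrite q1 invrN invr1 -opprD.
have cC i j : c i j = c j i by rewrite /c mC.
have [|rho rhoE] := univ _ (simple_matrix c_diag); last first.
  by exists c, rho; split=> // i; rewrite rhoE.
move=> i j; apply: invertible_eq; rewrite invertible_valX invertible_valM /=.
(* Label 0 stands for oo and imposes no relation, and label 1 forces [i = j]. Labels above 2 use the
   dihedral relation. For label 2 the root of unity has order 4, so [c i j] vanishes and the two
   matrices commute. *)
case: (ltngtP (m i j) 2) => [m2|m2|m2].
- case em : (m i j) m2 => [|[|//]] _; first by rewrite expr0.
  have [<-|/m_neq1//] := pselect (i = j); exact: simple_invol.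
- have q_prim := qP (m i j) (ltnW (ltnW m2)).
  have cq : c i j = q (m i j) + (q (m i j))^-1.
    by rewrite /c /cm; case: (m i j) m2.
  apply: dihedral_relation m2 q_prim _ _ _ _; rewrite -?cq; try exact: root_part_sqr.
    by rewrite root_partMM [c j i]cC.
  by rewrite root_partMM [c j i]cC.
have cij : c i j = 0.
  rewrite /c m2 /cm; have p4 := qP 2 isT; have q0 : q 2 != 0.
    apply/eqP => q0; have /eqP := prim_expr_order p4.
    by rewrite q0 expr0n eq_sym oner_eq0.
  have q2 : q 2 ^+ 2 = -1.
    have /eqP : (q 2 ^+ 2) ^+ 2 = 1 by rewrite -exprM; exact: prim_expr_order p4.
    rewrite sqrf_eq1 => /orP[q1|/eqP//].
    by have := prim_order_dvd p4 2; rewrite q1.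
  by apply: (mulfI q0); rewrite mulr0 mulrDr -expr2 q2 divff // addNr.
have XY : root_part c i * root_part c j = 0 by rewrite root_partM cij scale0r.
have YX : root_part c j * root_part c i = 0 by rewrite root_partM cC cij scale0r.
have com : (1 + root_part c i) * (1 + root_part c j)
    = (1 + root_part c j) * (1 + root_part c i).
  by rewrite !mulrDl !mul1r !mulrDr !mulr1 XY YX !addr0 -!addrA [_ + root_part c i]addrC.
rewrite m2 expr2 {2}com mulrA -(mulrA (1 + root_part c i)) simple_invol // mulr1.
exact: simple_invol.
Qed.

Lemma mxrank_conj (rho : {multiplicative W -> invertible 'M[algC]_n.+1}) x w :
  (\rank ((rho (x * w * x^-1)%g).1 - 1)%R <= \rank ((rho w).1 - 1)%R)%N.
Proof.
have -> : (rho (x * w * x^-1)%g).1 - 1 = (rho x).1 * ((rho w).1 - 1) * (rho x).2.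
  by rewrite mulrBr mulrBl mulr1 invertible_mulV !gmulfM multiplicativeV.
rewrite -mulmxE; apply: leq_trans (mxrankM_maxl _ _) _; exact: mxrankM_maxr.
Qed.

(** The rank of [rho v - 1] is subadditive in v, at most 1 on reflections and not increased by
    conjugation; for the product of commuting letters it is at least their number. *)
Lemma absolute_lower_bound ks k x : uniq ks ->
  {in ks &, forall i j, s i * s j = s j * s i}%g ->
  product_of (reflection s) k (x * wprod s ks * x^-1)%g -> (size ks <= k)%N.
Proof.
move=> uks com; set w := wprod s ks.
have [c [rho [c_diag rhoE]]] := geometric_representation.
pose rk v := \rank ((rho v).1 - 1)%R.
have rk_reflection t : reflection s t -> (rk t <= 1)%N.
  move=> [i [v ->]]; apply: leq_trans (mxrank_conj rho v (s i)) _.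
  by rewrite rhoE addrC addKr; exact: mxrank_root_part.
have rk_le j v : product_of (reflection s) j v -> (rk v <= j)%N.
  move=> [ts [<- rts ->]]; elim: ts rts => [|t ts IH] rts.
    by rewrite big_nil /rk multiplicative1 invertible_val1 subrr mxrank0.
  rewrite big_cons /rk gmulfM invertible_valM.
  set a := (rho t).1; set b := (rho _).1.
  have -> : a * b - 1 = (a - 1) * b + (b - 1) by rewrite mulrBl mul1r addrA subrK.
  apply: leq_trans (mxrank_add _ _) _; apply: (@leq_add _ _ 1 (size ts)).
    apply: leq_trans (mxrankM_maxl _ _) _; apply: rk_reflection.
    by apply: rts; rewrite mem_head.
  by apply: IH => u uts; apply: rts; rewrite inE uts orbT.
move=> /rk_le; apply: leq_trans; apply: leq_trans (mxrank_conj rho x^-1 _).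
rewrite invgK !mulgA mulVg mul1g mulgVK -/(rk w).
pose e j : 'rV[algC]_n.+1 := delta_mx 0 j.
have eS j i : e j *m (rho (s i)).1 = e j + c j i *: e i.
  by rewrite rhoE mulmxDr mulmx1 -rowE root_part_row.
(* Commutation is read off in the representation: on [e j], the two orders of multiplication have
   i-th coordinates [c j i] and [- c j i]. *)
have orth i j : i \in ks -> j \in ks -> i != j -> c j i = 0.
  move=> iks jks ij.
  have := congr1 (fun v => e j *m (rho v).1) (com _ _ iks jks).
  rewrite !gmulfM !invertible_valM -!mulmxE !mulmxA !eS !mulmxDl -!scalemxAl !eS.
  move=> /(congr1 (fun v : 'rV_n.+1 => v 0 i)).
  rewrite !mxE !eqxx (negbTE ij) c_diag /= !mulr0 !mulr1 !addr0 !add0r => /eqP.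
  rewrite mulr1 eq_sym -subr_eq0 addrAC subrr add0r mulf_eq0 oppr_eq0 pnatr_eq0.
  by move=> /eqP.
have ew' j l : {subset l <= ks} -> uniq l -> j \in ks ->
    e j *m (rho (wprod s l)).1 = if j \in l then - e j else e j.
  move=> sl ul jks; elim: l sl ul => [|i l IH] sl /=.
    by rewrite wprod_nil multiplicative1 invertible_val1 mulmx1.
  case/andP=> il ul.
  have {}IH := IH (fun k' k'l => sl k' (@mem_behead _ (i :: l) k' k'l)) ul.
  rewrite wprod_cons gmulfM invertible_valM -mulmxE mulmxA eS inE.
  have iks := sl i (mem_head _ _).
  case: eqVneq => [eji|nji] /=.
    rewrite -eji c_diag -{1}[e j]scale1r -scalerDl opprD addNKr scaleN1r mulNmx IH.
    by rewrite eji (negbTE il).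
  by rewrite (orth i j iks jks) 1?eq_sym // scale0r addr0 IH.
have ew j : j \in ks -> e j *m (rho w).1 = - e j.
  by move=> jks; rewrite ew' ?jks.
(* The rows [e j] for j in [ks] are independent and w negates each of them, so
   [U *m (rho w - 1) = -2 *: U] has full row rank. *)
pose U : 'M[algC]_(size ks, n.+1) := \matrix_(r < size ks) e (tnth (in_tuple ks) r).
have UU : U *m U^T = 1%:M.
  apply/matrixP => r r'; rewrite !mxE (bigD1 (tnth (in_tuple ks) r)) //=.
  rewrite big1 => [|k' nk].
    rewrite !mxE !eqxx mul1r addr0 (inj_eq _) //; exact/tuple_uniqP.
  by rewrite !mxE (negbTE nk) andbF mul0r.
have UW : U *m ((rho w).1 - 1) = - 2 *: U.
  apply/row_matrixP => r; rewrite row_mul !rowK linearZ /= rowK mulmxBr mulmx1.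
  rewrite ew ?mem_tnth // scaleNr scaler_nat mulr2n opprD //.
have rU : (size ks <= \rank U)%N.
  by rewrite -[X in (X <= _)%N](mxrank1 algC) -UU mxrankM_maxl.
apply: leq_trans rU _; rewrite /rk -(eqmx_scale U (_ : - 2 != 0)).
  by rewrite -UW mxrankM_maxr.
by rewrite oppr_eq0 pnatr_eq0.
Qed.

End AbsoluteLowerBound.

(** * Distinct-letter expressions and their lengths *)

Section Stats.
Variables (I : eqType) (W : groupType) (s : I -> W).
Hypothesis cox : coxeter_system s.
Implicit Types (i j : I) (L M A : seq I).

Local Notation comm i j := (s i * s j == s j * s i).

(** The element and both lengths travel together, so that one rewriting of the word preserves all
    three. *)
Definition stats L := (star_prod s L, star_len s L, star_abs s L).

Lemma stats_cons i L : stats (i :: L) =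
  if s i * star_prod s L == star_prod s L * s i
  then (star_prod s L * s i, (star_len s L).+1, (star_abs s L).+1)
  else (s i * star_prod s L * s i, (star_len s L).+2, star_abs s L).
Proof. by rewrite /stats star_prod_cons /star /=; case: ifP. Qed.

Lemma eq_stats_cons i L L' : stats L = stats L' -> stats (i :: L) = stats (i :: L').
Proof. by rewrite !stats_cons => -[-> -> ->]. Qed.

Lemma eq_stats_cat A L L' : stats L = stats L' -> stats (A ++ L) = stats (A ++ L').
Proof. by move=> e; elim: A => //= i A; exact: eq_stats_cons. Qed.

Lemma uniq_stats_cons i L : uniq (i :: L) -> stats (i :: L) =
  if all (fun j => comm i j) L
  then (star_prod s L * s i, (star_len s L).+1, (star_abs s L).+1)
  else (s i * star_prod s L * s i, (star_len s L).+2, star_abs s L).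
Proof. by move=> uiL; rewrite stats_cons star_prod_commute. Qed.

Lemma stats_swap i j L : uniq (i :: j :: L) -> s i * s j = s j * s i ->
  stats (i :: j :: L) = stats (j :: i :: L).
Proof.
move=> uijL cij; have ujiL : uniq (j :: i :: L).
  by rewrite -(perm_uniq (_ : perm_eq (i :: j :: L) _)) // (perm_catCA [:: i] [:: j]).
have [/andP[_ ujL] /andP[_ uiL]] := (uijL, ujiL).
have := uniq_stats_cons uijL; have := uniq_stats_cons ujiL.
rewrite /= cij eqxx /= => -> ->.
have := uniq_stats_cons ujL; have := uniq_stats_cons uiL.
by do 2 case: (all _ L); move=> [-> -> ->] [-> -> ->]; congr (_, _, _);
   rewrite -?mulgA ?cij // ?mulgA ?cij // -!mulgA cij.
Qed.

Lemma stats_front A i L : uniq (A ++ i :: L) -> all (fun j => comm i j) A ->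
  stats (A ++ i :: L) = stats (i :: A ++ L).
Proof.
elim: A => //= j A IH /andP[jA uA] /andP[/eqP cij cA].
rewrite (eq_stats_cons j (IH uA cA)); apply: stats_swap => //.
have p : perm_eq (j :: A ++ i :: L) (j :: i :: A ++ L).
  by rewrite perm_cons (perm_catCA A [:: i]).
by rewrite -(perm_uniq p) /= jA.
Qed.

(** In either order the first letter acts by a commuting step and the second by conjugation. The
    products are [star_prod s L] times the two sides of the braid relation. *)
Lemma stats_braid i j L : uniq (i :: j :: L) -> s i * s j * s i = s j * s i * s j ->
  s i * s j <> s j * s i ->
  all (fun k => comm i k) L -> all (fun k => comm j k) L ->
  stats (i :: j :: L) = stats (j :: i :: L).
Proof.
move=> uijL braid ncij ci cj; have ujiL : uniq (j :: i :: L).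
  by rewrite -(perm_uniq (_ : perm_eq (i :: j :: L) _)) // (perm_catCA [:: i] [:: j]).
have [/andP[_ ujL] /andP[_ uiL]] := (uijL, ujiL).
rewrite (uniq_stats_cons uijL) (uniq_stats_cons ujiL) /=.
move/eqP/negbTE: ncij => ncij; rewrite [s j * s i == _]eq_sym ncij /=.
have := uniq_stats_cons ujL; rewrite cj => -[-> -> ->].
have := uniq_stats_cons uiL; rewrite ci => -[-> -> ->].
have cLi : s i * star_prod s L = star_prod s L * s i.
  by apply/eqP; rewrite star_prod_commute.
have cLj : s j * star_prod s L = star_prod s L * s j.
  by apply/eqP; rewrite star_prod_commute.
congr (_, _, _).
by rewrite !mulgA cLi cLj -!mulgA; congr (_ * _); rewrite !mulgA braid.
Qed.

End Stats.

(** * Boolean involutions of the groups W_i as distinct-letter words *)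

Section Counting.
Variables (n : nat) (W : groupType) (s : 'I_n.+1 -> W).
Hypothesis cox : coxeter_system s.
Implicit Types (i : nat) (j : 'I_n.+1) (L M : seq 'I_n.+1) (w : W).

(** Written as in [first_gens], so that [gens s (below i)] is convertible to [first_gens s i]. *)
Definition below i : pred 'I_n.+1 := fun j => (j.+1 <= i)%N.

(** Reflections of the parabolic subgroup are reflections of W, so the rank bound in W applies and
    matches the factorization given by the word. *)
Lemma absolute_length_star_prod (J : pred 'I_n.+1) L : uniq L -> all J L ->
  absolute_length (gens s J) (star_prod s L) = star_abs s L.
Proof.
move=> uL JL; apply: word_length_eq; first exact: product_of_star_prod.
move=> k [ts [<- Jts e]]; have [x _ [ks [uks _ <- com ex]]] := star_prod_conj cox uL.
apply: (@absolute_lower_bound _ _ _ cox ks _ x) => //; rewrite -ex e.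
by exists ts; split=> // t /Jts; exact: reflections_reflection.
Qed.

Lemma boolean_involutionsP i l a w : boolean_involutions s i l a w <->
  exists L, [/\ uniq L, all (below i) L & stats s L = (w, l, a)].
Proof.
have eS : first_gens s i = gens s (below i) by [].
rewrite /boolean_involutions eS; split=> [[]|[L [uL iL [<- <- <-]]]].
  move=> /(boolean_involution_star cox)[L [uL iL ->]].
  rewrite coxeter_length_gens //; last exact: star_prod_parabolic.
  by rewrite len_star_prod // absolute_length_star_prod // => <- <-; exists L.
split; first exact: boolean_star_prod.
  rewrite coxeter_length_gens //; last exact: star_prod_parabolic.
  by rewrite len_star_prod.
exact: absolute_length_star_prod.
Qed.

Lemma boolean_parabolic i l a w :
  boolean_involutions s i l a w -> in_parabolic s (below i) w.
Proof. by move=> /boolean_involutionsP[L [_ iL [<- _ _]]]; exact: star_prod_parabolic. Qed.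

Lemma belowS i i' : (i <= i')%N -> subpred (below i) (below i').
Proof. by move=> ii' k; rewrite /below => /leq_trans; apply. Qed.

Lemma boolean_involutionsS i i' l a w : (i <= i')%N ->
  boolean_involutions s i l a w -> boolean_involutions s i' l a w.
Proof.
move=> ii' /boolean_involutionsP[L [uL iL eL]]; apply/boolean_involutionsP.
by exists L; split=> //; apply: sub_all iL; exact: belowS.
Qed.

(* A Boolean element of W_(i.+1) is outside W_i iff the last generator occurs in
   its support. *)
Lemma boolean_involutionsDP i j l a w : nat_of_ord j = i ->
  boolean_involutions s i.+1 l a w /\ ~ boolean_involutions s i l a w <->
  exists L, [/\ uniq L, all (below i.+1) L, j \in L & stats s L = (w, l, a)].
Proof.
move=> ji; split=> [[/boolean_involutionsP[L [uL iL eL]] nw]|[L [uL iL jL eL]]].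
  exists L; split=> //; apply: contra_notT nw => jL.
  apply/boolean_involutionsP; exists L; split=> //; apply/allP => k kL.
  have := allP iL k kL; rewrite /below ltnS leq_eqVlt => /predU1P[ki|//].
  by case/negP: jL; rewrite (_ : j = k) //; apply: val_inj; rewrite /= ji ki.
split; first by apply/boolean_involutionsP; exists L.
move/boolean_parabolic; case: eL => <- _ _ /(star_prod_support cox uL)/allP/(_ j jL).
by rewrite /below ji ltnn.
Qed.

End Counting.

(** * The recurrence *)

Section Recurrence.
Variables (k : nat) (W : groupType) (s : 'I_k.+3 -> W).
Hypothesis cox : coxeter_system s.
Implicit Types (j : 'I_k.+3) (L M : seq 'I_k.+3) (w : W).

(** With [n = k.+3] and indices from 0, these are the indices of s_n, s_(n-1) and s_(n-2). *)
Let p : 'I_k.+3 := @Ordinal k.+3 k.+2 (ltnSn _).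
Let q : 'I_k.+3 := @Ordinal k.+3 k.+1 (ltnW (ltnSn _)).
Let r : 'I_k.+3 := @Ordinal k.+3 k (ltnW (ltnW (ltnSn _))).

Hypothesis comm_p : forall j, (j < k.+1)%N -> s p * s j = s j * s p.
Hypothesis comm_q : forall j, (j < k)%N -> s q * s j = s j * s q.
Hypothesis braid_pq : s p * s q * s p = s q * s p * s q.
Hypothesis braid_qr : s q * s r * s q = s r * s q * s r.

Let braid_noncomm i j : i != j -> s i * s j * s i = s j * s i * s j ->
  s i * s j <> s j * s i.
Proof.
move=> /eqP ij braid com; apply: ij; have [inj _] := cox; apply: inj.
by apply: (mulgI (s i * s j)); rewrite braid com.
Qed.

Lemma stats_last M : uniq M -> all (@below k.+2 k.+1) M ->
  stats s (p :: M) = (star_prod s M * s p, (star_len s M).+1, (star_abs s M).+1).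
Proof.
move=> uM kM; have pM : p \notin M.
  by apply/negP => /(allP kM); rewrite /below ltnNge ltnW.
rewrite uniq_stats_cons //=; last by rewrite pM.
by rewrite (_ : all _ M) //; apply/allP => j /(allP kM) jk; apply/eqP/comm_p.
Qed.

(** Since p fails to commute only with q, it reaches the front at once when q acts before it.
    Otherwise the adjacent pair q, p can be braided, unless r acts before both. *)
Lemma normal_form L : uniq L -> p \in L -> q \in L ->
  (exists M, [/\ uniq M, all (@below k.+2 k.+2) M, q \in M
                & stats s L = stats s (p :: M)])
  \/ (exists M, [/\ uniq M, all (@below k.+2 k.+1) M, r \in M
                 & stats s L = stats s (q :: p :: M)]).
Proof.
have cases j : [\/ j = p, j = q, j = r | (j < k)%N].
  have := ltn_ord j; rewrite ltnS leq_eqVlt => /predU1P[jp|].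
    by apply: Or41; exact: val_inj.
  rewrite ltnS leq_eqVlt => /predU1P[jq|].
    by apply: Or42; exact: val_inj.
  rewrite ltnS leq_eqVlt => /predU1P[jr|?]; last exact: Or44.
  by apply: Or43; exact: val_inj.
have lt_p j : j != p -> (j < k.+2)%N.
  by case: (cases j) => [->|->|->|/leqW/leqW] //; rewrite eqxx.
have lt_q j : j != p -> j != q -> (j < k.+1)%N.
  by case: (cases j) => [->|->|->|/leqW] //; rewrite eqxx.
have lt_r j : j != p -> j != q -> j != r -> (j < k)%N.
  by case: (cases j) => [->|->|->|//]; rewrite eqxx.
have front_p A B : uniq (A ++ p :: B) -> q \in B ->
    exists M, [/\ uniq M, all (@below k.+2 k.+2) M, q \in M
      & stats s (A ++ p :: B) = stats s (p :: M)].
  move=> u qB; have u' : uniq (p :: A ++ B).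
    by rewrite -(uniq_catCA A [:: p] B).
  have /= /andP[pAB uAB] := u'.
  exists (A ++ B); split=> //.
  - apply/allP => j jAB; apply: lt_p; apply: contraNneq pAB => <-; exact: jAB.
  - by rewrite mem_cat qB orbT.
  apply: stats_front => //; apply/allP => j jA; apply/eqP/comm_p/lt_q.
    by apply: contraNneq pAB => <-; rewrite mem_cat jA.
  apply: contraTneq qB => <-; move: u; rewrite cat_uniq => /and3P[_ /hasPn h _].
  by apply/negP => jB; have := h j; rewrite inE jB orbT jA => /(_ isT).
move=> uL /splitPr pL; case: pL uL => A B uL.
rewrite mem_cat inE => /or3P[qA|/eqP/(congr1 val)/eqP|qB]; last first.
- by left; exact: front_p.
- by rewrite /= ltn_eqF.
case/splitPr: qA uL => A1 A2; rewrite -catA cat_cons => uL.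
(* p moves to the left until it meets q. *)
have e1 : stats s (A1 ++ q :: A2 ++ p :: B) = stats s (A1 ++ q :: p :: A2 ++ B).
  have : uniq (q :: A2 ++ p :: B) by move: uL; rewrite cat_uniq => /and3P[].
  rewrite cons_uniq => /andP[qAB uAB]; apply/eq_stats_cat/eq_stats_cons/stats_front => //.
  apply/allP => j jA; apply/eqP/comm_p/lt_q.
    move: uAB; rewrite (uniq_catCA A2 [:: p] B) => /= /andP[pAB _].
    by apply: contraNneq pAB => <-; rewrite mem_cat jA.
  by apply: contraNneq qAB => <-; rewrite mem_cat jA.
have {uL} : uniq (A1 ++ q :: p :: A2 ++ B).
  rewrite -(perm_uniq (_ : perm_eq (A1 ++ q :: A2 ++ p :: B) _)) //.
  by rewrite perm_cat2l perm_cons (perm_catCA A2 [:: p]).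
rewrite e1; move: (A2 ++ B) => D {A2 B e1} uL.
have uL' : uniq (q :: p :: A1 ++ D).
  by move: uL; rewrite (uniq_catCA A1 [:: q; p] D).
have [qp qAD pAD uAD] :
    [/\ q != p, q \notin A1 ++ D, p \notin A1 ++ D & uniq (A1 ++ D)].
  by move: uL' => /= /and3P[]; rewrite inE negb_or => /andP[].
have braid_left E : uniq (q :: p :: E) -> (forall j, j \in E -> j < k)%N ->
    stats s (q :: p :: E) = stats s (p :: q :: E).
  move=> uE ltE; apply: stats_braid => //.
  - exact: braid_noncomm.
  - by apply/allP => j /ltE jk; apply/eqP/comm_q.
  - by apply/allP => j /ltE /leqW jk; apply/eqP/comm_p.
have notin j x (E : seq 'I_k.+3) : x \notin E -> j \in E -> j != x.
  by move=> xE jE; apply: contraNneq xE => <-.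
have lt_D (E : seq 'I_k.+3) : {subset E <= A1 ++ D} -> r \notin E ->
    forall j, j \in E -> (j < k)%N.
  move=> sE rE j jE; have jAD := sE j jE.
  exact: lt_r _ (notin _ _ _ pAD jAD) (notin _ _ _ qAD jAD) (notin _ _ _ rE jE).
(* If r acts after q, the letters of D commute with both p and q, so the pair can be braided and p
   goes to the front. *)
have [rA|rA] := boolP (r \in A1).
  have uD : uniq (q :: p :: D) by move: uL; rewrite cat_uniq => /and3P[].
  have rD : r \notin D.
    move: uAD; rewrite cat_uniq => /and3P[_ /hasPn h _].
    by apply/negP => /h; rewrite /= rA.
  left; rewrite (eq_stats_cat A1 (braid_left D uD _)).
    apply: front_p; last exact: mem_head.
    rewrite -(perm_uniq (_ : perm_eq (A1 ++ q :: p :: D) _)) // perm_cat2l.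
    by rewrite (perm_catCA [:: q] [:: p]).
  by apply: lt_D rD => j; rewrite mem_cat orbC => ->.
(* Without r in A1, first q and then p pass over A1. *)
rewrite stats_front //; last first.
  apply/allP => j jA; apply/eqP/comm_q; apply: lt_D rA j jA => j.
  by rewrite mem_cat => ->.
have e2 : stats s (A1 ++ p :: D) = stats s (p :: A1 ++ D).
  apply: (stats_front cox); first by rewrite (uniq_catCA A1 [:: p] D) /= pAD.
  apply/allP => j jA; have jAD : j \in A1 ++ D by rewrite mem_cat jA.
  exact/eqP/comm_p/(lt_q _ (notin _ _ _ pAD jAD) (notin _ _ _ qAD jAD)).
rewrite (eq_stats_cons q e2).
(* An r in the rest gives the second form; without r the pair is braided into the first form. *)
have [rE|rE] := boolP (r \in A1 ++ D).
  right; exists (A1 ++ D); split=> //; apply/allP => j jAD.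
  exact: lt_q _ (notin _ _ _ pAD jAD) (notin _ _ _ qAD jAD).
left; exists (q :: A1 ++ D); split.
- by rewrite /= qAD.
- apply/allP => j; rewrite inE => /predU1P[->|jAD]; first exact: ltnSn.
  exact: lt_p _ (notin _ _ _ pAD jAD).
- exact: mem_head.
- by apply: braid_left => // j; apply: lt_D.
Qed.

Lemma p_notin (M : seq 'I_k.+3) i :
  (i <= k.+2)%N -> all (@below k.+2 i) M -> p \notin M.
Proof.
by move=> ik /allP iM; apply/negP => /iM; rewrite /below ltnNge /= (leq_trans ik).
Qed.

Lemma q_notin (M : seq 'I_k.+3) : all (@below k.+2 k.+1) M -> q \notin M.
Proof. by move=> /allP iM; apply/negP => /iM; rewrite /below ltnn. Qed.

Lemma pq_noncomm : s p * s q <> s q * s p.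
Proof. by apply: braid_noncomm braid_pq; rewrite -val_eqE /= gtn_eqF. Qed.

Lemma uniq_p (M : seq 'I_k.+3) i : (i <= k.+2)%N -> uniq M -> all (@below k.+2 i) M ->
  uniq (p :: M).
Proof. by move=> ik uM iM; rewrite cons_uniq (p_notin ik iM). Qed.

Lemma uniq_qp M : uniq M -> all (@below k.+2 k.+1) M -> uniq (q :: p :: M).
Proof.
move=> uM kM; rewrite cons_uniq inE negb_or q_notin // (uniq_p (leqnSn _) uM kM) !andbT.
by rewrite -val_eqE /= ltn_eqF.
Qed.

Lemma stats_pq M : uniq M -> all (@below k.+2 k.+2) M -> q \in M ->
  stats s (p :: M) = (s p * star_prod s M * s p, (star_len s M).+2, star_abs s M).
Proof.
move=> uM kM qM; rewrite (uniq_stats_cons cox); last exact: uniq_p kM.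
by case: allP => // /(_ q qM)/eqP/pq_noncomm.
Qed.

Lemma stats_qp M : uniq M -> all (@below k.+2 k.+1) M ->
  stats s (q :: p :: M) =
    (s q * (star_prod s M * s p) * s q, (star_len s M).+3, (star_abs s M).+1).
Proof.
move=> uM kM; have e := stats_last uM kM; rewrite (uniq_stats_cons cox (uniq_qp uM kM)).
case: allP => [/(_ p (mem_head _ _))/eqP/esym/pq_noncomm //|_].
have e1 : star_prod s (p :: M) = star_prod s M * s p := congr1 (fun t => t.1.1) e.
have e2 : star_len s (p :: M) = (star_len s M).+1 := congr1 (fun t => t.1.2) e.
have e3 : star_abs s (p :: M) = (star_abs s M).+1 := congr1 snd e.
by rewrite e1 e2 e3.
Qed.

(** The shifts record the steps: p commuting adds 1 to both lengths, p conjugating adds 2 and 0, and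
    p commuting followed by q conjugating adds 3 and 1. The negated memberships express that q,
    respectively r, occurs. *)
Lemma boolean_involutions_decomposition l a w :
  boolean_involutions s k.+3 l.+3 a.+1 w <->
  [\/ boolean_involutions s k.+2 l.+3 a.+1 w,
      exists2 u, boolean_involutions s k.+1 l.+2 a u & w = u * s p,
      exists2 v, boolean_involutions s k.+2 l.+1 a.+1 v
                 /\ ~ boolean_involutions s k.+1 l.+1 a.+1 v
               & w = s p * v * s p
    | exists2 u, boolean_involutions s k.+1 l a u /\ ~ boolean_involutions s k l a u
               & w = s q * (u * s p) * s q].
Proof.
split; last first.
  case.
  - exact: (boolean_involutionsS cox (leqnSn k.+2)).
  - move=> [u /(boolean_involutionsP cox)[M [uM kM [<- el ea]]] ->].
    apply/(boolean_involutionsP cox); exists (p :: M); split.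
    + exact: uniq_p kM.
    + by apply/allP => j _; exact: ltn_ord.
    + by rewrite stats_last // el ea.
  - move=> [v /(boolean_involutionsDP cox _ _ _ (erefl : nat_of_ord q = k.+1))].
    move=> [M [uM kM qM [<- el ea]]] ->; apply/(boolean_involutionsP cox).
    exists (p :: M); split.
    + exact: uniq_p kM.
    + by apply/allP => j _; exact: ltn_ord.
    + by rewrite stats_pq // el ea.
  - move=> [v /(boolean_involutionsDP cox _ _ _ (erefl : nat_of_ord r = k))].
    move=> [M [uM kM rM [<- el ea]]] ->; apply/(boolean_involutionsP cox).
    exists (q :: p :: M); split.
    + exact: uniq_qp.
    + by apply/allP => j _; exact: ltn_ord.
    + by rewrite stats_qp // el ea.
move=> /(boolean_involutionsP cox)[L [uL kL eL]].
have [pL|pL] := boolP (p \in L); last first.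
  apply: Or41; apply/(boolean_involutionsP cox); exists L; split=> //.
  apply/allP => j jL; have := allP kL j jL; rewrite /below ltnS leq_eqVlt.
  case/predU1P=> // jp; case/negP: pL; rewrite (_ : p = j) //; exact/val_inj.
have [qL|qL] := boolP (q \in L).
  have [[M [uM kM qM eM]]|[M [uM kM rM eM]]] := normal_form uL pL qL.
  - apply: Or43; exists (star_prod s M).
      apply/(boolean_involutionsDP cox _ _ _ (erefl : nat_of_ord q = k.+1)).
      exists M; split=> //; move: eL; rewrite eM stats_pq // => -[_ el ea].
      by rewrite /stats -ea; congr (_, _, _); case: el.
    by move: eL; rewrite eM stats_pq // => -[].
  - apply: Or44; exists (star_prod s M).
      apply/(boolean_involutionsDP cox _ _ _ (erefl : nat_of_ord r = k)).
      exists M; split=> //; move: eL; rewrite eM stats_qp // => -[_ el ea].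
      by rewrite /stats; congr (_, _, _); [case: el|case: ea].
    by move: eL; rewrite eM stats_qp // => -[].
case/splitPr: pL uL kL qL eL => A B uL kL qL eL.
have /= /andP[pM uM] : uniq (p :: A ++ B) by rewrite -(uniq_catCA A [:: p] B).
have kM : all (@below k.+2 k.+1) (A ++ B).
  apply/allP => j jM; have jL : j \in A ++ p :: B.
    by move: jM; rewrite !mem_cat inE => /orP[->|->]; rewrite ?orbT.
  have := allP kL j jL; rewrite /below ltnS leq_eqVlt => /predU1P[jp|].
    by case/negP: pM; rewrite (_ : p = j) //; exact/val_inj.
  rewrite ltnS leq_eqVlt => /predU1P[jq|//].
  by case/negP: qL; rewrite (_ : q = j) //; exact/val_inj.
apply: Or42; exists (star_prod s (A ++ B)).
  apply/(boolean_involutionsP cox); exists (A ++ B); split=> //.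
  move: eL; rewrite (stats_front cox) // ?stats_last //; last first.
    apply/allP => j jA; apply/eqP/comm_p/(allP kM); by rewrite mem_cat jA.
  by move=> [_ el ea]; rewrite /stats; congr (_, _, _); [case: el|case: ea].
move: eL; rewrite (stats_front cox) // ?stats_last //; first by case.
by apply/allP => j jA; apply/eqP/comm_p/(allP kM); rewrite mem_cat jA.
Qed.

Lemma p_not_below i : (i <= k.+2)%N -> ~~ @below k.+2 i p.
Proof. by rewrite /below -leqNgt. Qed.

Lemma q_not_below : ~~ @below k.+2 k.+1 q.
Proof. by rewrite /below -leqNgt. Qed.

Lemma new_p_noncomm l a v :
  boolean_involutions s k.+2 l a v /\ ~ boolean_involutions s k.+1 l a v ->
  s p * v <> v * s p.
Proof.
move=> /(boolean_involutionsDP cox _ _ _ (erefl : nat_of_ord q = k.+1)).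
move=> [M [uM kM qM [<- _ _]]] /eqP.
rewrite (star_prod_commute cox); last exact: uniq_p kM.
by move=> /allP/(_ q qM)/eqP/pq_noncomm.
Qed.

Lemma new_q_noncomm l a u :
  boolean_involutions s k.+1 l a u /\ ~ boolean_involutions s k l a u ->
  s q * u <> u * s q.
Proof.
move=> /(boolean_involutionsDP cox _ _ _ (erefl : nat_of_ord r = k)).
move=> [M [uM kM rM [<- _ _]]] /eqP.
rewrite (star_prod_commute cox); last by rewrite cons_uniq q_notin.
move=> /allP/(_ r rM)/eqP; apply: braid_noncomm braid_qr.
by rewrite -val_eqE /= gtn_eqF.
Qed.

(* Otherwise s_p would conjugate x = s_q u s_q into the parabolic subgroup
   without s_p, hence commute with x, although s_q belongs to the support of x. *)
Lemma conj_last_neq u v : in_parabolic s (@below k.+2 k.+1) u -> s q * u <> u * s q ->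
  in_parabolic s (@below k.+2 k.+2) v ->
  s p * v * s p <> s q * (u * s p) * s q.
Proof.
move=> Pu /eqP nu Pv e; have Pq : in_parabolic s (@below k.+2 k.+2) (s q).
  by apply: parabolic_gen; rewrite /below.
have [ws [kws rws eu]] := parabolic_reduced cox Pu.
set x := s q * u * s q.
have ex : x = wprod s (q :: rcons ws q) by rewrite wprod_cons wprod_rcons -eu mulgA.
have kw : all (@below k.+2 k.+2) (q :: rcons ws q).
  rewrite /= all_rcons /= /below leqnn /=.
  by apply: sub_all kws; exact: belowS.
have rx : reduced s (q :: rcons ws q).
  rewrite /reduced -ex (len_conj_new cox Pu q_not_below nu) eu /=.
  by rewrite size_rcons !eqSS.
have Px : in_parabolic s (@below k.+2 k.+2) x by rewrite ex; exact: parabolic_wprod.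
have epx : s p * x * s p = v * s q.
  have -> : v = s p * (s q * (u * s p) * s q) * s p.
    by rewrite -e !mulgA (coxeter_system_gen_invol _ cox) mul1g gen_mulKr.
  rewrite /x -!mulgA; congr (_ * (_ * (_ * _))).
  by move: braid_pq; rewrite -!mulgA => <-; rewrite gen_mulK.
have com : s p * x = x * s p.
  apply: (parabolic_conj_commute cox Px); first exact: p_not_below.
  by rewrite epx; exact: parabolicM.
apply: pq_noncomm; apply: (commute_letters cox kw rx (p_not_below (leqnn _))).
  by rewrite -ex.
exact: mem_head.
Qed.

(** Equality would keep [u * s p] in the parabolic subgroup without q under conjugation by [s q].
    Then q would commute with every letter of its support, p among them. *)
Lemma conj_middle_neq u u' : in_parabolic s (@below k.+2 k.+1) u ->
  in_parabolic s (@below k.+2 k.+1) u' -> s q * (u * s p) * s q <> u' * s p.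
Proof.
move=> Pu Pu' e; pose J : pred 'I_k.+3 := predC1 q.
have qJ : ~~ J q by rewrite /J /= eqxx.
have Jp : J p by rewrite /J /= -val_eqE /= gtn_eqF.
have sJ : subpred (@below k.+2 k.+1) J.
  by move=> j; rewrite /J /= /below -val_eqE /= => /ltn_eqF->.
have PJ v : in_parabolic s (@below k.+2 k.+1) v -> in_parabolic s J (v * s p).
  by move=> Pv; apply: parabolicM (parabolicS sJ Pv) _; exact: parabolic_gen.
have com : s q * (u * s p) = u * s p * s q.
  by apply: (parabolic_conj_commute cox (PJ u Pu) qJ); rewrite e; exact: PJ.
have [ws [kws rws eu]] := parabolic_reduced cox Pu.
have ews : u * s p = wprod s (rcons ws p) by rewrite wprod_rcons -eu.
have rw : reduced s (rcons ws p).
  rewrite /reduced -ews (len_Mgen_new cox Pu (p_not_below (leqnSn _))) size_rcons eqSS.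
  by rewrite eu.
have Jw : all J (rcons ws p) by rewrite all_rcons Jp; apply: sub_all kws.
apply: pq_noncomm; apply/esym/(commute_letters cox Jw rw qJ).
  by rewrite -ews.
by rewrite mem_rcons mem_head.
Qed.

Lemma mul_p_notin i u : (i <= k.+2)%N -> in_parabolic s (@below k.+2 i) u ->
  ~ in_parabolic s (@below k.+2 i) (u * s p).
Proof.
move=> ik Pu /(parabolicMr cox Pu)/(parabolic_genP cox).
exact/negP/p_not_below.
Qed.

Local Notation F i l a := (fset_set (boolean_involutions s i l a)).

(** Subtracted terms are moved to the left to stay in the natural numbers. The four classes of the
    decomposition are disjoint, and each map from the smaller group is injective by cancellation. *)
Lemma num_boolean_recurrence l a :
  (num_boolean s k.+3 l.+3 a.+1 + num_boolean s k.+1 l.+1 a.+1 + num_boolean s k l a =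
   num_boolean s k.+2 l.+3 a.+1 + num_boolean s k.+2 l.+1 a.+1
   + num_boolean s k.+1 l.+2 a + num_boolean s k.+1 l a)%N.
Proof.
have inF i l' a' w : reflect (boolean_involutions s i l' a' w) (w \in F i l' a').
  rewrite in_fset_set; last exact: boolean_involutions_finite.
  by apply: (iffP idP); rewrite inE.
pose X1 := [fset u * s p | u in F k.+1 l.+2 a]%fset.
pose X2 := [fset s p * v * s p | v in F k.+2 l.+1 a.+1 `\` F k.+1 l.+1 a.+1]%fset.
pose X3 := [fset s q * (u * s p) * s q | u in F k.+1 l a `\` F k l a]%fset.
have eF : F k.+3 l.+3 a.+1 = (F k.+2 l.+3 a.+1 `|` X1 `|` (X2 `|` X3))%fset.
  apply/fsetP => w; rewrite !in_fsetU.
  apply/(inF k.+3)/orP => [/boolean_involutions_decomposition[]|].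
  - by move=> /inF Bw; left; rewrite Bw.
  - by move=> [u /inF Bu ->]; left; rewrite [_ \in X1]in_imfset ?orbT.
  - move=> [v [/inF Bv nv] ->]; right; apply/orP; left.
    by apply: in_imfset; rewrite /= in_fsetD Bv andbT; apply/negP => /inF.
  - move=> [u [/inF Bu nu] ->]; right; apply/orP; right.
    by apply: in_imfset; rewrite /= in_fsetD Bu andbT; apply/negP => /inF.
  move=> H; apply/boolean_involutions_decomposition; move: H.
  move=> [/orP[/inF Bw|/imfsetP[u /= /inF Bu ->]]|/orP[]/imfsetP[u /=]].
  - exact: Or41.
  - by apply: Or42; exists u.
  - rewrite in_fsetD => /andP[/negP nv /inF Bv] ->; apply: Or43; exists u => //.
    by split=> // /inF.
  - rewrite in_fsetD => /andP[/negP nv /inF Bv] ->; apply: Or44; exists u => //.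
    by split=> // /inF.
have XX1 w : w \in X1 -> exists2 u, in_parabolic s (@below k.+2 k.+1) u & w = u * s p.
  by move=> /imfsetP[u /= /inF/(boolean_parabolic cox) Bu ->]; exists u.
have XX2 w : w \in X2 -> exists v, [/\ in_parabolic s (@below k.+2 k.+2) v,
    s p * v <> v * s p & w = s p * v * s p].
  move=> /imfsetP[v /=]; rewrite in_fsetD => /andP[/negP nv /inF Bv] ->.
  exists v; split=> //; first exact: boolean_parabolic Bv.
  by apply: new_p_noncomm; split; [exact: Bv|move/inF].
have XX3 w : w \in X3 -> exists u, [/\ in_parabolic s (@below k.+2 k.+1) u,
    s q * u <> u * s q & w = s q * (u * s p) * s q].
  move=> /imfsetP[u /=]; rewrite in_fsetD => /andP[/negP nu /inF Bu] ->.
  exists u; split=> //; first exact: boolean_parabolic Bu.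
  by apply: new_q_noncomm; split; [exact: Bu|move/inF].
have Pq : in_parabolic s (@below k.+2 k.+2) (s q).
  by apply: parabolic_gen; rewrite /below.
have P12 u :
    in_parabolic s (@below k.+2 k.+1) u -> in_parabolic s (@below k.+2 k.+2) u.
  by apply: parabolicS; exact: belowS.
have nP u : in_parabolic s (@below k.+2 k.+2) u ->
    ~ in_parabolic s (@below k.+2 k.+2) (u * s p).
  exact: mul_p_notin.
have cardU (A B : {fset W}) : [disjoint A & B]%fset ->
    #|` (A `|` B)%fset| = (#|` A| + #|` B|)%N.
  by move=> /eqP AB; rewrite cardfsU AB cardfs0 subn0.
have D01 : [disjoint F k.+2 l.+3 a.+1 & X1]%fset.
  apply/fdisjointP_sym => w /XX1[u Pu ->]; apply/negP => /inF/(boolean_parabolic cox).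
  exact/nP/P12.
have D23 : [disjoint X2 & X3]%fset.
  apply/fdisjointP => w /XX2[v [Pv _ ->]]; apply/negP => /XX3[u [Pu nu]].
  exact: conj_last_neq.
have D0123 : [disjoint F k.+2 l.+3 a.+1 `|` X1 & X2 `|` X3]%fset.
  apply/fdisjointP_sym => w; rewrite !in_fsetU.
  (* An element [s p * v * s p] without p in its support would make p commute with v. Other
     coincidences cancel to put [s p] into the parabolic subgroup without p, or are excluded by
     [conj_middle_neq]. *)
  move=> /orP[/XX2[v [Pv nv ->]]|/XX3[u [Pu nu ->]]].
    apply/negP => /orP[/inF/(boolean_parabolic cox) Pw|/XX1[u Pu e]].
      exact/nv/(parabolic_conj_commute cox Pv (p_not_below (leqnn _)) Pw).
    apply: (nP 1); first exact: parabolic1.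
    rewrite mul1g.
    by apply: (parabolicMl cox Pv); rewrite (mulIg _ _ _ e); exact: P12.
  apply/negP => /orP[/inF/(boolean_parabolic cox) Pw|/XX1[u' Pu' e]].
    apply: (nP _ (P12 u Pu)); apply: (parabolicMr cox Pq).
    exact: (parabolicMl cox Pq).
  exact: conj_middle_neq e.
rewrite /num_boolean eF !cardU //.
have -> : #|` X1| = #|` F k.+1 l.+2 a| by rewrite card_imfset // => u v /mulIg.
have -> : #|` X2| = #|` (F k.+2 l.+1 a.+1 `\` F k.+1 l.+1 a.+1)%fset|.
  by rewrite card_imfset // => u v /mulIg/mulgI.
have -> : #|` X3| = #|` (F k.+1 l a `\` F k l a)%fset|.
  by rewrite card_imfset // => u v /mulIg/mulgI/mulIg.
have sub i i' l' a' : (i <= i')%N -> (F i l' a' `<=` F i' l' a')%fset.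
  by move=> ii'; apply/fsubsetP => w /inF Bw; apply/inF; exact: boolean_involutionsS Bw.
have s1 := sub k k.+1 l a (leqnSn _).
have s2 := sub k.+1 k.+2 l.+1 a.+1 (leqnSn _).
rewrite !cardfsDS // -!addnA; congr addn.
(* Both differences are taken between nested sets, so the truncated subtractions of cardinals are
   exact. *)
have := subnK (fsubset_leq_card s1); have := subnK (fsubset_leq_card s2).
lia.
Qed.

End Recurrence.

Theorem theorem4p1 (n : nat) (W : groupType) (s : 'I_n -> W)
  (hn : (3 <= n)%N)
  (hcox : coxeter_system s)
  (* 'I_n is 0-based: s i is the generator s_(i.+1) *)
  (hcomm_n : forall i j : 'I_n, i.+1 = n -> (j.+1 <= n - 2)%N ->
     (s i * s j = s j * s i)%g)
  (hcomm_n1 : forall i j : 'I_n, i.+1 = (n - 1)%N -> (j.+1 <= n - 3)%N ->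
     (s i * s j = s j * s i)%g)
  (hbraid_n : forall i j : 'I_n, i.+1 = n -> j.+1 = (n - 1)%N ->
     (s i * s j * s i = s j * s i * s j)%g)
  (hbraid_n1 : forall i j : 'I_n, i.+1 = (n - 1)%N -> j.+1 = (n - 2)%N ->
     (s i * s j * s i = s j * s i * s j)%g)
  (l a : nat) (hl : (3 <= l)%N) (ha : (1 <= a)%N) :
  ((num_boolean s n l a)%:Z =
     (num_boolean s (n - 1) l a)%:Z + (num_boolean s (n - 1) (l - 2) a)%:Z
   + (num_boolean s (n - 2) (l - 1) (a - 1))%:Z
   - (num_boolean s (n - 2) (l - 2) a)%:Z
   + (num_boolean s (n - 2) (l - 3) (a - 1))%:Z
   - (num_boolean s (n - 3) (l - 3) (a - 1))%:Z)%R.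
Proof.
(* Writing n and l as successors three times over, and a as a successor, removes every truncated
   subtraction from the statement. *)
case: n s hn hcox hcomm_n hcomm_n1 hbraid_n hbraid_n1 => [|[|[|k]]] // s _ cox.
case: l hl => [|[|[|l]]] // _; case: a ha => // a _.
rewrite !subSS !subn0 => comm_p comm_q braid_pq braid_qr.
have := num_boolean_recurrence cox
  (fun j => comm_p (@Ordinal _ k.+2 _) j erefl)
  (fun j => comm_q (@Ordinal _ k.+1 _) j erefl)
  (braid_pq (@Ordinal _ k.+2 _) (@Ordinal _ k.+1 _) erefl erefl)
  (braid_qr (@Ordinal _ k.+1 _) (@Ordinal _ k _) erefl erefl) l a.
lia.
Qed.
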